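(* There is an algorithm which, given an integer $n\ge 1$ and the letter lengths $0\le c_1\le c_2\le\cdots\le c_r$ of an alphabet of $r\ge 2$ letters, computes in $O(n\log^2 r)$ time a tree representing an optimal prefix code with $n$ equiprobable codewords, i.e. a prefix-free set of $n$ words over the alphabet whose average length is minimum among all prefix-free sets of $n$ words over the alphabet.
   Context: Words are finite strings over an alphabet of $r$ letters; the $i$th letter has length $c_i$ (a non-negative real number). The length of a word is the sum of the lengths of its letters. A prefix code (prefix-free set) is a set of words none of which is a prefix of another. Each of the $n$ codewords occurs with probability $1/n$, so the average length is $\frac1n$ times the sum of the lengths of the codewords. A prefix code is represented by a finite rooted subtree, containing the root, of the infinite $r$-ary tree (in which the edge from a node to its $i$th child is labeled with the $i$th letter and has length $c_i$), with $n$ of its leaves designated as terminals; the codewords are the words spelled by the labels along the paths from the root to the terminals. Running time counts elementary operations, each arithmetic operation or comparison on numbers taking unit time. The letter lengths are given in sorted order and are available by random access. *)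

(* Defs.v *)
From mathcomp Require Import all_boot all_order all_algebra.
From mathcomp Require Import finmap.
From mathcomp Require Import reals exp.

Set Implicit Arguments.
Unset Strict Implicit.
Unset Printing Implicit Defensive.

Import Order.TTheory GRing.Theory Num.Theory.

Local Open Scope fset_scope.
Local Open Scope ring_scope.

(** * Words, prefix codes, code trees *)

Notation word r := (seq 'I_r).

Definition word_length (R : realType) (r : nat) (c : 'I_r -> R) (w : word r) : R :=
  \sum_(i <- w) c i.

Definition prefix_free (r : nat) (W : {fset word r}) : Prop :=
  forall u v, u \in W -> v \in W -> prefix u v -> u = v.

Definition average_length (R : realType) (r : nat) (c : 'I_r -> R)
    (W : {fset word r}) : R :=
  (\sum_(w <- W) word_length c w) / #|` W|%:R.

Definition optimal_code (R : realType) (r : nat) (c : 'I_r -> R) (n : nat)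
    (W : {fset word r}) : Prop :=
  [/\ prefix_free W, #|` W| = n &
      forall W' : {fset word r}, prefix_free W' -> #|` W'| = n ->
        average_length c W <= average_length c W'].

(* A node of the infinite r-ary tree is identified with the word spelled on the
   path from the root to it, so that the i-th child of u is [rcons u i]. *)
Definition rooted_subtree (r : nat) (T : {fset word r}) : Prop :=
  [::] \in T /\
  forall (u : word r) (i : 'I_r), rcons u i \in T -> u \in T.

Definition leaf (r : nat) (T : {fset word r}) (u : word r) : Prop :=
  u \in T /\ forall i : 'I_r, rcons u i \notin T.

(* The set of terminals of a code tree is also its set of codewords. *)
Definition code_tree (r : nat) (T W : {fset word r}) : Prop :=
  rooted_subtree T /\ forall w, w \in W -> leaf T w.

(** * The machine

   A unit-cost real RAM, presented as an imperative language. Memory has an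
   integer part and a real part; each consists of registers and of arrays with
   computed subscripts. A program mentions finitely many registers and arrays,
   so this is the usual linear memory up to interleaving.

   Lengths are real numbers, on which +, -, *, / and comparisons are available.
   Integers are natural numbers used for counters and subscripts, with +,
   truncated -, halving and comparisons. There is no unit-cost multiplication
   or division of unbounded integers, and no rounding of reals to integers,
   since these would make the machine unreasonably powerful. *)

Inductive iexpr : Type :=
| IConst of nat
| IVar of nat
| IArr of nat & iexpr
| IAdd of iexpr & iexpr
| ISub of iexpr & iexpr
| IHalf of iexpr.

Inductive rexpr : Type :=
| RVar of nat
| RArr of nat & iexpr
| RCast of iexpr
| RAdd of rexpr & rexpr
| RSub of rexpr & rexpr
| RMul of rexpr & rexpr
| RDiv of rexpr & rexpr.

Inductive bexpr : Type :=
| BIle of iexpr & iexpr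
| BIeq of iexpr & iexpr
| BRle of rexpr & rexpr
| BReq of rexpr & rexpr
| BNot of bexpr
| BAnd of bexpr & bexpr.

Inductive cmd : Type :=
| Skip
| ISetVar of nat & iexpr
| ISetArr of nat & iexpr & iexpr
| RSetVar of nat & rexpr
| RSetArr of nat & iexpr & rexpr
| Seq of cmd & cmd
| If of bexpr & cmd & cmd
| While of bexpr & cmd.

Record state (R : realType) : Type := State {
  ivar : nat -> nat;
  iarr : nat -> nat -> nat;
  rvar : nat -> R;
  rarr : nat -> nat -> R
}.

Definition upd (V : Type) (f : nat -> V) (x : nat) (v : V) : nat -> V :=
  fun y => if y == x then v else f y.

Definition upd2 (V : Type) (f : nat -> nat -> V) (a i : nat) (v : V) :
    nat -> nat -> V :=
  upd f a (upd (f a) i v).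

Fixpoint ieval (R : realType) (s : state R) (e : iexpr) : nat :=
  match e with
  | IConst k => k
  | IVar x => ivar s x
  | IArr a e1 => iarr s a (ieval s e1)
  | IAdd e1 e2 => (ieval s e1 + ieval s e2)%N
  | ISub e1 e2 => (ieval s e1 - ieval s e2)%N
  | IHalf e1 => (ieval s e1)./2
  end.

Fixpoint reval (R : realType) (s : state R) (e : rexpr) : R :=
  match e with
  | RVar x => rvar s x
  | RArr a e1 => rarr s a (ieval s e1)
  | RCast e1 => (ieval s e1)%:R
  | RAdd e1 e2 => reval s e1 + reval s e2
  | RSub e1 e2 => reval s e1 - reval s e2
  | RMul e1 e2 => reval s e1 * reval s e2
  | RDiv e1 e2 => reval s e1 / reval s e2
  end.

Fixpoint beval (R : realType) (s : state R) (b : bexpr) : bool :=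
  match b with
  | BIle e1 e2 => (ieval s e1 <= ieval s e2)%N
  | BIeq e1 e2 => ieval s e1 == ieval s e2
  | BRle e1 e2 => reval s e1 <= reval s e2
  | BReq e1 e2 => reval s e1 == reval s e2
  | BNot b1 => ~~ beval s b1
  | BAnd b1 b2 => beval s b1 && beval s b2
  end.

(* The cost of an expression is its number of nodes: every constant, register
   access, array access, arithmetic operation and comparison takes unit time. *)
Fixpoint icost (e : iexpr) : nat :=
  match e with
  | IConst _ | IVar _ => 1
  | IArr _ e1 | IHalf e1 => (icost e1).+1
  | IAdd e1 e2 | ISub e1 e2 => (icost e1 + icost e2).+1
  end.

Fixpoint rcost (e : rexpr) : nat :=
  match e with
  | RVar _ => 1
  | RArr _ e1 | RCast e1 => (icost e1).+1
  | RAdd e1 e2 | RSub e1 e2 | RMul e1 e2 | RDiv e1 e2 =>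
      (rcost e1 + rcost e2).+1
  end.

Fixpoint bcost (b : bexpr) : nat :=
  match b with
  | BIle e1 e2 | BIeq e1 e2 => (icost e1 + icost e2).+1
  | BRle e1 e2 | BReq e1 e2 => (rcost e1 + rcost e2).+1
  | BNot b1 => (bcost b1).+1
  | BAnd b1 b2 => (bcost b1 + bcost b2).+1
  end.

(* [exec s p t s'] : started in s, the program p halts in s' after time t. *)
Inductive exec (R : realType) : state R -> cmd -> nat -> state R -> Prop :=
| ExecSkip s : exec s Skip 1 s
| ExecISetVar s x e :
    exec s (ISetVar x e) (icost e).+1
      (State (upd (ivar s) x (ieval s e)) (iarr s) (rvar s) (rarr s))
| ExecISetArr s a e1 e2 :
    exec s (ISetArr a e1 e2) (icost e1 + icost e2).+1
      (State (ivar s) (upd2 (iarr s) a (ieval s e1) (ieval s e2))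
         (rvar s) (rarr s))
| ExecRSetVar s x e :
    exec s (RSetVar x e) (rcost e).+1
      (State (ivar s) (iarr s) (upd (rvar s) x (reval s e)) (rarr s))
| ExecRSetArr s a e1 e2 :
    exec s (RSetArr a e1 e2) (icost e1 + rcost e2).+1
      (State (ivar s) (iarr s) (rvar s)
         (upd2 (rarr s) a (ieval s e1) (reval s e2)))
| ExecSeq s s1 s2 p1 p2 t1 t2 :
    exec s p1 t1 s1 -> exec s1 p2 t2 s2 -> exec s (Seq p1 p2) (t1 + t2)%N s2
| ExecIfTrue s s' b p1 p2 t :
    beval s b -> exec s p1 t s' -> exec s (If b p1 p2) (bcost b + t)%N s'
| ExecIfFalse s s' b p1 p2 t :
    ~~ beval s b -> exec s p2 t s' -> exec s (If b p1 p2) (bcost b + t)%N s'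
| ExecWhileTrue s s1 s2 b p t1 t2 :
    beval s b -> exec s p t1 s1 -> exec s1 (While b p) t2 s2 ->
    exec s (While b p) (bcost b + t1 + t2)%N s2
| ExecWhileFalse s b p :
    ~~ beval s b -> exec s (While b p) (bcost b) s.

(** * Input and output conventions *)

(* n and r are in integer registers 0 and 1, the letter lengths in cells
   0, ..., r-1 of real array 0, and all other cells contain 0. *)
Definition input_state (R : realType) (n r : nat) (c : 'I_r -> R) : state R :=
  State
    (fun x => if x == 0%N then n else if x == 1%N then r else 0%N)
    (fun _ _ => 0%N)
    (fun _ => 0)
    (fun a i => if a == 0%N then (if insub i is Some j then c j else 0) else 0).

(* The nodes of the tree are numbered 0, ..., N-1, where N is in integer
   register 0, and the root is node 0. For each other node v, cell v of integer
   array 0 is the number of its parent and cell v of integer array 1 is the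
   (0-based) letter labeling the edge from its parent. For every node v, cell v
   of integer array 2 is nonzero when v is a terminal, and zero otherwise.
   [node v] is the word spelled on the path from the root to v. *)
Definition output_tree (R : realType) (r : nat) (s : state R)
    (T W : {fset word r}) : Prop :=
  let N := ivar s 0 in
  exists node : nat -> word r,
    [/\ forall u, u \in T <-> exists2 v : nat, (v < N)%N & node v = u,
        forall v1 v2, (v1 < N)%N -> (v2 < N)%N -> node v1 = node v2 -> v1 = v2,
        (0 < N)%N /\ node 0%N = [::],
        forall v, (0 < v < N)%N ->
          (iarr s 0 v < N)%N /\
          exists2 i : 'I_r, nat_of_ord i = iarr s 1 v &
                            node v = rcons (node (iarr s 0 v)) i &
        forall v, (v < N)%N -> (node v \in W) = (iarr s 2 v != 0%N)].

(* Main.v *)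
Require Import Defs.
From mathcomp Require Import all_boot all_order all_algebra.
From mathcomp Require Import finmap.
From mathcomp Require Import reals exp.
From mathcomp Require Import boolp zify ring lra.

Set Implicit Arguments.
Unset Strict Implicit.
Unset Printing Implicit Defensive.

Import Order.TTheory GRing.Theory Num.Theory.

Local Open Scope ring_scope.

(** Fix the number m of internal nodes. Exchanging subtrees shows that it is
    best to make the m shallowest nodes internal and to take as codewords the n
    shallowest of the other children of internal nodes; call this tree T_m.
    Going from T_m to T_(m+1), the shallowest leaf a becomes internal and its
    children replace the deepest leaves. If a + c_2 is at least the depth of
    the deepest leaf, every later expansion yields at most one useful child and
    the cost cannot decrease any more, so the search stops there and returns to
    the cheapest tree met so far.

    The children of the internal nodes by a given letter are sorted by depth,
    so a tree is described by two counters per letter, and its shallowest and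
    deepest leaves are found by two tournaments over the r letters, at cost
    O(log r) per update. If node m receives k children, then the k m children
    of the nodes 1, ..., m by the letters 1, ..., k are all in the tree, as
    leaves or as internal nodes, whence k m <= n + m. As also k <= r, the number
    of updates is O(sum_m min(r, n / m + 1)) = O(n log r). *)

(** * Executing programs *)

(** Optimality of each T_m is not proved separately. The invariant [undecided] says that any code
    with n words is either no better than the recorded tree, or can be rearranged at no greater cost
    so that the N nodes numbered so far are internal. Every expansion preserves this, and when the
    search stops the second alternative implies the first. The lower bound is a pricing argument:
    each codeword is charged the depth tau of the deepest selected leaf, and no frontier subtree may
    gain more than a single leaf in its place would. The time bound also needs m <= n. A node other
    than the root is expanded only if fewer than n leaves are present or its second child would be
    strictly shallower than the deepest leaf; hence it receives k >= 2 children, and k m <= n + m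
    gives m <= n. Copying the r row counters at each improvement would be too slow, so moves are
    logged and later undone, each undo being paid for by the move that it reverts. The codewords get
    their node numbers by n further extractions of a shallowest leaf. *)

Definition runs (R : realType) (s : state R) (p : cmd) (T : nat)
    (Q : state R -> Prop) : Prop :=
  exists t s', [/\ exec s p t s', (t <= T)%N & Q s'].

Fixpoint loop_free (p : cmd) : bool :=
  match p with
  | Seq p1 p2 | If _ p1 p2 => loop_free p1 && loop_free p2
  | While _ _ => false
  | _ => true
  end.

(** The [While] case, here and in [cost_bound], is a placeholder: both functions serve for loop-free
    programs, where the run is given by computation. *)
Fixpoint final (R : realType) (s : state R) (p : cmd) : state R :=
  match p with
  | Skip | While _ _ => s
  | ISetVar x e =>
      State (upd (ivar s) x (ieval s e)) (iarr s) (rvar s) (rarr s)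
  | ISetArr a e1 e2 =>
      State (ivar s) (upd2 (iarr s) a (ieval s e1) (ieval s e2))
        (rvar s) (rarr s)
  | RSetVar x e =>
      State (ivar s) (iarr s) (upd (rvar s) x (reval s e)) (rarr s)
  | RSetArr a e1 e2 =>
      State (ivar s) (iarr s) (rvar s)
        (upd2 (rarr s) a (ieval s e1) (reval s e2))
  | Seq p1 p2 => final (final s p1) p2
  | If b p1 p2 => if beval s b then final s p1 else final s p2
  end.

Fixpoint cost_bound (p : cmd) : nat :=
  match p with
  | Skip | While _ _ => 1
  | ISetVar _ e => (icost e).+1
  | ISetArr _ e1 e2 => (icost e1 + icost e2).+1
  | RSetVar _ e => (rcost e).+1
  | RSetArr _ e1 e2 => (icost e1 + rcost e2).+1
  | Seq p1 p2 => cost_bound p1 + cost_bound p2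
  | If b p1 p2 => bcost b + (cost_bound p1 + cost_bound p2)
  end.

Section Runs.
Variable R : realType.
Implicit Types (s : state R) (p : cmd) (Q : state R -> Prop).

Lemma exec_final s p :
  loop_free p -> exists2 t, exec s p t (final s p) & (t <= cost_bound p)%N.
Proof.
elim: p s => //=.
- by move=> s; exists 1%N => //; constructor.
- by move=> x e s _; eexists; [constructor|].
- by move=> a e1 e2 s _; eexists; [constructor|].
- by move=> x e s _; eexists; [constructor|].
- by move=> a e1 e2 s _; eexists; [constructor|].
- move=> p1 IH1 p2 IH2 s /andP[l1 l2].
  have [t1 e1 b1] := IH1 s l1; have [t2 e2 b2] := IH2 (final s p1) l2.
  by exists (t1 + t2)%N; [exact: ExecSeq e1 e2|exact: leq_add].
- move=> b p1 IH1 p2 IH2 s /andP[l1 l2].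
  case: ifPn => hb.
    have [t e h] := IH1 s l1; exists (bcost b + t)%N; first exact: ExecIfTrue.
    lia.
  have [t e h] := IH2 s l2; exists (bcost b + t)%N; first exact: ExecIfFalse.
  lia.
Qed.

Lemma runs_weaken s p T T' Q Q' :
  (T <= T')%N -> (forall s', Q s' -> Q' s') -> runs s p T Q -> runs s p T' Q'.
Proof.
by move=> le QQ [t [s' [e b q]]]; exists t, s'; split => //;
  [exact: leq_trans le|exact: QQ].
Qed.

Lemma runs_final s p Q T :
  loop_free p -> (cost_bound p <= T)%N -> Q (final s p) -> runs s p T Q.
Proof.
move=> l h q; have [t e b] := exec_final s l.
by exists t, (final s p); split => //; exact: leq_trans h.
Qed.

Lemma runs_seq s p1 p2 T1 T2 T Q1 Q :
  runs s p1 T1 Q1 -> (forall s1, Q1 s1 -> runs s1 p2 T2 Q) ->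
  (T1 + T2 <= T)%N -> runs s (Seq p1 p2) T Q.
Proof.
move=> [t1 [s1 [e1 b1 q1]]] h le; have [t2 [s2 [e2 b2 q2]]] := h _ q1.
exists (t1 + t2)%N, s2; split => //; first exact: ExecSeq e1 e2.
by apply: leq_trans le; exact: leq_add.
Qed.

Lemma runs_if s b p1 p2 T T' Q :
  (beval s b -> runs s p1 T Q) -> (~~ beval s b -> runs s p2 T Q) ->
  (bcost b + T <= T')%N -> runs s (If b p1 p2) T' Q.
Proof.
move=> h1 h2 le; case: (boolP (beval s b)) => hb.
  have [t [s' [e h q]]] := h1 hb; exists (bcost b + t)%N, s'; split => //.
    exact: ExecIfTrue.
  lia.
have [t [s' [e h q]]] := h2 hb; exists (bcost b + t)%N, s'; split => //.
  exact: ExecIfFalse.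
lia.
Qed.

(* The potential f bounds the time still to be spent in the loop, and so also
   proves termination. *)
Lemma runs_while (I : state R -> Prop) (f : state R -> nat) s b p T :
  (forall s, I s -> beval s b -> exists T1,
     runs s p T1 (fun s' => I s' /\ (bcost b + T1 + f s' <= f s)%N)) ->
  I s -> (f s + bcost b <= T)%N ->
  runs s (While b p) T (fun s' => I s' /\ ~~ beval s' b).
Proof.
move=> body; have [m] := ubnP (f s).
elim: m s T => // m IH s T lt i le; case: (boolP (beval s b)) => hb; last first.
  exists (bcost b), s; split => //; last lia.
  exact: ExecWhileFalse.
have bpos : (0 < bcost b)%N by case: (b).
have [T1 [t1 [s1 [e1 b1 [i1 f1]]]]] := body s i hb.
have [|t2 [s2 [e2 b2 q2]]] := IH s1 (f s1 + bcost b)%N _ i1 (leqnn _).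
  lia.
exists (bcost b + t1 + t2)%N, s2; split => //; last lia.
exact: ExecWhileTrue e1 e2.
Qed.

End Runs.

(* Evaluates accesses to explicit registers and arrays of an updated state. *)
Ltac rd := cbv beta iota zeta delta [upd2];
  repeat match goal with |- context [@upd ?V ?f ?x ?v ?y] =>
   first [ change (@upd V f x v y) with (f y)
         | (constr_eq x y; change (@upd V f x v y) with v) ] end;
  cbv beta.

Section Upd.
Variable V : Type.
Implicit Types (f : nat -> V).

Lemma upd_same f x v : upd f x v x = v.
Proof. by rewrite /upd eqxx. Qed.

Lemma upd_other f x v y : y != x -> upd f x v y = f y.
Proof. by rewrite /upd => /negbTE ->. Qed.

Lemma upd_upd f x v v' : upd (upd f x v) x v' = upd f x v'.
Proof. by apply/funext => y; rewrite /upd; case: eqP. Qed.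

Lemma upd_id f x : upd f x (f x) = f.
Proof. by apply/funext => y; rewrite /upd; case: eqP => // ->. Qed.

Lemma upd_comm f x x' v v' :
  x != x' -> upd (upd f x v) x' v' = upd (upd f x' v') x v.
Proof.
move=> ne; apply/funext => y; rewrite /upd.
by case: eqP => // ->; rewrite eq_sym (negbTE ne).
Qed.

End Upd.

(** * Tournament trees *)

(* A tournament over the letters 0, ..., r-1 is a binary tree stored in cells
   1, ..., 2r-1 of an array: letter i sits at cell r + i and the parent of cell
   v is cell v./2. A cell holds 0, or i + 1 if letter i wins there. *)
Definition under (r u i : nat) : Prop := exists k, iter k half (r + i)%N = u.

Section Tournament.
Variable R : realType.
Implicit Types (act : nat -> bool) (key : nat -> R) (w : nat -> nat).

Definition champion act key (r u x : nat) : Prop :=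
  (forall i, (i < r)%N -> under r u i -> act i ->
     (0 < x)%N /\ key (x - 1)%N <= key i) /\
  ((0 < x)%N -> [/\ (x - 1 < r)%N, under r u (x - 1) & act (x - 1)%N]).

Definition tournament act key (r : nat) w : Prop :=
  forall u, (0 < u < r + r)%N -> champion act key r u (w u).

(** The test has exactly the shape of the Boolean expression in [pull], so that [final_pull] holds
    by computation. *)
Definition winner key (x y : nat) : nat :=
  if (x != 0%N) && ~~ ((y != 0%N) && ~~ (key (x - 1)%N <= key (y - 1)%N))
  then x else y.

Lemma iter_half_anti a k k' :
  (k <= k')%N -> (iter k' half a <= iter k half a)%N.
Proof.
move/subnK <-; elim: (k' - k)%N => //= d IH.
by apply: leq_trans IH; lia.
Qed.

Lemma iter_half_gt0 r i : (0 < r + i)%N -> under r 1 i.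
Proof.
have [m] := ubnP (r + i)%N; rewrite /under.
elim: m (r + i)%N => // m IH [//|[_ _|a lt _]]; first by exists 0%N.
have [||k hk] := IH a.+2./2; rewrite /=; try lia.
by exists k.+1; rewrite iterSr.
Qed.

Lemma under_children r u i : (0 < u < r)%N ->
  under r u i <-> under r (u + u) i \/ under r (u + u + 1) i.
Proof.
move=> hu; split.
  move=> [[|k] /= hk]; first by move: hk; lia.
  have : iter k half (r + i) = (u + u)%N \/ iter k half (r + i) = (u + u + 1)%N.
    by move: hk; move: (iter k half _) => z; lia.
  by case=> e; [left|right]; exists k.
by case=> -[k hk]; exists k.+1; rewrite /= hk; lia.
Qed.

Lemma under_leaf r i i' : (i < r)%N -> (i' < r)%N ->
  under r (r + i) i' -> i' = i.
Proof.
move=> hi hi' [[|k]] /=; first lia.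
have /= := @iter_half_anti (r + i') 0 k isT.
lia.
Qed.

Lemma champion_winner act key r u x y : (0 < u < r)%N ->
  champion act key r (u + u) x -> champion act key r (u + u + 1) y ->
  champion act key r u (winner key x y).
Proof.
move=> hu [x1 x2] [y1 y2]; rewrite /winner.
have uc i := under_children i hu.
case: x x1 x2 => [|x] x1 x2 /=.
  split=> [i hi /uc[] h ai|/y2[] h1 h2 h3].
  - by have [] := x1 i hi h ai.
  - exact: y1.
  - by split => //; apply/uc; right.
case: y y1 y2 => [|y] y1 y2 /=.
  split=> [i hi /uc[] h ai|/x2[] h1 h2 h3].
  - exact: x1.
  - by have [] := y1 i hi h ai.
  - by split => //; apply/uc; left.
rewrite negbK; case: leP => [le|/ltW le].
  split=> [i hi /uc[] h ai|/x2[] h1 h2 h3].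
  - exact: x1.
  - by have [_ h'] := y1 i hi h ai; split=> //; apply: le_trans h'.
  - by split => //; apply/uc; left.
split=> [i hi /uc[] h ai|/y2[] h1 h2 h3].
- by have [_ h'] := x1 i hi h ai; split=> //; apply: le_trans h'.
- exact: y1.
- by split => //; apply/uc; right.
Qed.

Lemma champion_other act act' key key' r u x i :
  (forall j, j != i -> act' j = act j /\ key' j = key j) ->
  ~ under r u i -> champion act key r u x -> champion act' key' r u x.
Proof.
move=> same nu [x1 x2].
have ne j : under r u j -> j != i by move=> h; apply/eqP => e; apply: nu; rewrite -e.
split.
  move=> j hj uj; have [-> ->] := same j (ne _ uj) => aj.
  have [xp le] := x1 j hj uj aj; split => //.
  by have [_ h _] := x2 xp; have [_ ->] := same _ (ne _ h).
by move=> /x2[h1 h2 h3]; split => //; have [-> _] := same _ (ne _ h2).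
Qed.

Lemma champion_leaf act key r i : (i < r)%N ->
  champion act key r (r + i) (if act i then i + 1 else 0).
Proof.
move=> hi; split.
  move=> j hj /(under_leaf hi hj) -> ->; split; first lia.
  by rewrite addnK.
case: ifP => // ai _; rewrite addnK; split => //.
by exists 0%N.
Qed.

(* The tournament is correct except at the proper ancestors of cell v, where v
   is itself an ancestor of the leaf of letter i. *)
Definition tournament_from act key (r : nat) w (i v : nat) : Prop :=
  [/\ under r v i, (0 < v < r + r)%N & forall u, (0 < u < r + r)%N ->
      (under r u i -> (v <= u)%N) -> champion act key r u (w u)].

Lemma tournament_from_leaf act act' key key' r w i x : (i < r)%N ->
  (forall j, j != i -> act' j = act j /\ key' j = key j) ->
  x = (if act' i then i + 1 else 0)%N ->
  tournament act key r w ->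
  tournament_from act' key' r (upd w (r + i) x) i (r + i).
Proof.
move=> hi same -> tr; split; [by exists 0%N|by lia|].
move=> u hu h; have [->|ne] := eqVneq u (r + i)%N.
  by rewrite upd_same; apply: champion_leaf.
rewrite upd_other //; apply: champion_other same _ (tr _ hu).
move=> ui; have := h ui; case: ui => k hk.
have /= := @iter_half_anti (r + i) 0 k isT; rewrite hk => le1 le2.
by case/eqP: ne; apply/eqP; rewrite eqn_leq le1.
Qed.

(** The ancestors of a leaf form a chain under halving, so an ancestor of leaf i smaller than v is
    at most [v./2]. Hence neither child of [v./2] is among the cells still to be repaired, and the
    match played there is correct. *)
Lemma tournament_from_up act key r w i v : (1 < v)%N ->
  tournament_from act key r w i v ->
  tournament_from act key r (upd w v./2 (winner key (w (v./2 + v./2)%N)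
    (w (v./2 + v./2 + 1)%N))) i v./2.
Proof.
move=> v1 [[k hk] hv tr].
have vu : v = (v./2 + v./2)%N \/ v = (v./2 + v./2 + 1)%N by lia.
set u := v./2 in vu *.
have hu : (0 < u < r)%N by rewrite /u; lia.
have anc z : under r z i -> (z < v)%N -> (z <= u)%N.
  move=> [k' hk'] lt; case: (leqP k' k) => h.
    by have := iter_half_anti (r + i) h; rewrite hk hk' leqNgt lt.
  by have := iter_half_anti (r + i) h; rewrite /= hk hk'.
split; [by exists k.+1; rewrite /= hk|by lia|].
move=> x hx hxu; have [->|ne] := eqVneq x u; last first.
  rewrite upd_other //; apply: tr => // ux; rewrite leqNgt; apply/negP => lt.
  by have := anc x ux lt; have := hxu ux; move/eqP: ne; lia.
rewrite upd_same; apply: champion_winner => //; apply: tr; try lia;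
  move=> uz; rewrite leqNgt; apply/negP => lt; have := anc _ uz lt; lia.
Qed.

Lemma tournament_from_root act key r w i v : (v <= 1)%N ->
  tournament_from act key r w i v -> tournament act key r w.
Proof. by move=> hv [_ _ h] u hu; apply: h => // _; lia. Qed.

Lemma tournament_root act key r w i : tournament act key r w ->
  (i < r)%N -> act i -> [/\ (0 < w 1)%N, (w 1 - 1 < r)%N, act (w 1 - 1)%N &
    key (w 1 - 1)%N <= key i].
Proof.
move=> tr hi ai; have /tr[h1 h2] : (0 < 1 < r + r)%N by lia.
have [|wp le] := h1 i hi _ ai; first by apply: iter_half_gt0; lia.
by have [? ? ?] := h2 wp.
Qed.

End Tournament.
(** * The program *)

Notation v_n := 0%N (only parsing).
Notation v_r := 1%N (only parsing).
Notation v_nodes := 2%N (only parsing).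
Notation v_cnt := 3%N (only parsing).
Notation v_i := 4%N (only parsing).
Notation v_row := 5%N (only parsing).
Notation v_p := 6%N (only parsing).
Notation v_b := 7%N (only parsing).
Notation v_cell := 8%N (only parsing).
Notation v_log := 9%N (only parsing).
Notation v_best := 10%N (only parsing).
Notation x_cost := 0%N (only parsing).
Notation x_best := 1%N (only parsing).
Notation a_par := 0%N (only parsing).
Notation a_let := 1%N (only parsing).
Notation a_term := 2%N (only parsing).
Notation a_p := 3%N (only parsing).
Notation a_b := 4%N (only parsing).
Notation a_min := 5%N (only parsing).
Notation a_max := 6%N (only parsing).
Notation a_lrow := 7%N (only parsing).
Notation a_lp := 8%N (only parsing).
Notation a_lb := 9%N (only parsing).
Notation a_c := 0%N (only parsing).
Notation a_dep := 1%N (only parsing).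
Notation a_kmin := 2%N (only parsing).
Notation a_kmax := 3%N (only parsing).

Notation "p ;; q" := (Seq p q) (at level 100, right associativity).

Definition pull (w k : nat) : cmd :=
  let v := IVar v_cell in
  let x := IArr w (IAdd v v) in
  let y := IArr w (IAdd (IAdd v v) (IConst 1)) in
  let zero e := BIeq e (IConst 0) in
  let key e := RArr k (ISub e (IConst 1)) in
  If (BAnd (BNot (zero x)) (BNot (BAnd (BNot (zero y))
        (BNot (BRle (key x) (key y))))))
    (ISetArr w v x) (ISetArr w v y).

(* The children by letter i of the internal nodes p_i, ..., b_i - 1 are the
   leaves of the current tree whose last letter is i. This sets p_i and b_i,
   for i in register v_row, and replays the two tournaments which find a
   shallowest leaf (keys a_kmin) and a deepest leaf (negated keys a_kmax). *)
Definition set_row_leaf : cmd :=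
  let i := IVar v_row in
  ISetArr a_p i (IVar v_p) ;;
  ISetArr a_b i (IVar v_b) ;;
  ISetVar v_cell (IAdd (IVar v_r) i) ;;
  If (BNot (BIle (IVar v_b) (IVar v_p)))
    (RSetArr a_kmin i (RAdd (RArr a_dep (IVar v_p)) (RArr a_c i)) ;;
     RSetArr a_kmax i (RSub (RCast (IConst 0))
       (RAdd (RArr a_dep (ISub (IVar v_b) (IConst 1))) (RArr a_c i))) ;;
     ISetArr a_min (IVar v_cell) (IAdd i (IConst 1)) ;;
     ISetArr a_max (IVar v_cell) (IAdd i (IConst 1)))
    (ISetArr a_min (IVar v_cell) (IConst 0) ;;
     ISetArr a_max (IVar v_cell) (IConst 0)).

Definition replay_step : cmd :=
  ISetVar v_cell (IHalf (IVar v_cell)) ;; pull a_min a_kmin ;; pull a_max a_kmax.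

Definition set_row : cmd :=
  set_row_leaf ;;
  While (BNot (BIle (IVar v_cell) (IConst 1))) replay_step.

Section SetRow.
Variable R : realType.
Implicit Types s : state R.

Lemma final_pull s w k :
  let v := ivar s v_cell in
  final s (pull w k) = State (ivar s)
    (upd2 (iarr s) w v (winner (rarr s k) (iarr s w (v + v)%N)
       (iarr s w (v + v + 1)%N))) (rvar s) (rarr s).
Proof. by rewrite /pull /winner /=; case: ifP. Qed.

Lemma final_seq s p q : final s (Seq p q) = final (final s p) q.
Proof. by []. Qed.

Definition active (p b : nat -> nat) (i : nat) : bool := (p i < b i)%N.

(** A letter without leaves keeps stale keys, so keys are constrained for active letters only. The
    form [0 - x] is what the machine computes, having no negation. *)
Definition rows_ok (r : nat) (c dep : nat -> R) (p b w1 w2 : nat -> nat)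
    (k1 k2 : nat -> R) : Prop :=
  [/\ tournament (active p b) k1 r w1, tournament (active p b) k2 r w2 &
      forall i, (i < r)%N -> active p b i ->
        k1 i = dep (p i) + c i /\ k2 i = 0 - (dep (b i - 1)%N + c i)].

Definition ok s : Prop :=
  rows_ok (ivar s v_r) (rarr s a_c) (rarr s a_dep) (iarr s a_p) (iarr s a_b)
    (iarr s a_min) (iarr s a_max) (rarr s a_kmin) (rarr s a_kmax).

Definition with_row s (i p b v : nat) (w1 w2 : nat -> nat)
    (k1 k2 : nat -> R) : state R :=
  State (upd (ivar s) v_cell v)
    (upd (upd (upd (upd (iarr s) a_p (upd (iarr s a_p) i p))
      a_b (upd (iarr s a_b) i b)) a_min w1) a_max w2)
    (rvar s) (upd (upd (rarr s) a_kmin k1) a_kmax k2).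

(** A leaf cell is below 2r, so this bounds the number of cells on a path to the root. *)
Definition log_time (r : nat) : nat := (trunc_log 2 (r + r)).+1.

Definition set_row_time (r : nat) : nat := 180 * log_time r.

Lemma set_rowP s :
  (ivar s v_row < ivar s v_r)%N -> ok s ->
  runs s set_row (set_row_time (ivar s v_r)) (fun s' => ok s' /\
    exists v w1 w2 k1 k2,
      s' = with_row s (ivar s v_row) (ivar s v_p) (ivar s v_b) v w1 w2 k1 k2).
Proof.
set r := ivar s v_r; set i := ivar s v_row; set p := ivar s v_p.
set b := ivar s v_b => hi [t1 t2 hk].
set p' := upd (iarr s a_p) i p; set b' := upd (iarr s a_b) i b.
pose act := active p' b'.
have actE j : j != i -> act j = active (iarr s a_p) (iarr s a_b) j.
  by move=> ne; rewrite /act /active /p' /b' !upd_other.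
pose Q s' := exists v w1 w2 k1 k2, [/\ s' = with_row s i p b v w1 w2 k1 k2,
  tournament_from act k1 r w1 i v, tournament_from act k2 r w2 i v &
  forall j, (j < r)%N -> act j -> k1 j = rarr s a_dep (p' j) + rarr s a_c j /\
    k2 j = 0 - (rarr s a_dep (b' j - 1)%N + rarr s a_c j)].
apply: (@runs_seq _ _ _ _ 60 (180 * (trunc_log 2 (r + r)) + 5) _ Q); last 1 first.
- by rewrite /set_row_time /log_time; lia.
- apply: runs_final => //; rewrite /set_row_leaf [final]lock /= -lock /=.
  rewrite -ltnNge; rd; rewrite -/i -/p -/b -/r.
  have ai : act i = (p < b)%N by rewrite /act /active /p' /b' !upd_same.
  exists (r + i)%N; case: ifP => lt; cbn.
    exists (upd (iarr s a_min) (r + i) (i + 1)), (upd (iarr s a_max) (r + i) (i + 1)).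
    exists (upd (rarr s a_kmin) i (rarr s a_dep p + rarr s a_c i)).
    exists (upd (rarr s a_kmax) i (0 - (rarr s a_dep (b - 1)%N + rarr s a_c i))).
    split.
    + reflexivity.
    + apply: (tournament_from_leaf hi _ _ t1); last by rewrite ai lt.
      by move=> j ne; split; [exact: actE|rewrite upd_other].
    + apply: (tournament_from_leaf hi _ _ t2); last by rewrite ai lt.
      by move=> j ne; split; [exact: actE|rewrite upd_other].
    + move=> j hj aj; have [->|ne] := eqVneq j i; first by rewrite /p' /b' !upd_same.
      have := hk j hj; rewrite -actE // => /(_ aj).
      by rewrite /p' /b' !upd_other.
  exists (upd (iarr s a_min) (r + i) 0%N), (upd (iarr s a_max) (r + i) 0%N).
  exists (rarr s a_kmin), (rarr s a_kmax).
  split.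
  + by rewrite /with_row !upd_id.
  + apply: (tournament_from_leaf hi _ _ t1); last by rewrite ai lt.
    by move=> j ne; split; [exact: actE|].
  + apply: (tournament_from_leaf hi _ _ t2); last by rewrite ai lt.
    by move=> j ne; split; [exact: actE|].
  + move=> j hj aj; have [e|ne] := eqVneq j i.
      have : act i by rewrite -e.
      by rewrite ai lt.
    have := hk j hj; rewrite -actE // => /(_ aj).
    by rewrite /p' /b' !upd_other.
move=> s1 q1.
(* Halving the cell number lowers [trunc_log] by one; 180 covers the 150 allowed for one step
   together with the loop test. *)
pose f (s' : state R) := (180 * trunc_log 2 (ivar s' v_cell))%N.
apply: (@runs_weaken _ _ _ (180 * (trunc_log 2 (r + r)) + 5) _
   (fun s' => Q s' /\ ~~ beval s' (BNot (BIle (IVar v_cell) (IConst 1))))) => //.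
  move=> _ [[v [w1 [w2 [k1 [k2 [-> T1 T2 K]]]]]] /= hv].
  move: hv; rewrite negbK; rd => hv.
  split; last by exists v, w1, w2, k1, k2.
  split; last exact: K.
  - exact: tournament_from_root hv T1.
  - exact: tournament_from_root hv T2.
apply: (runs_while (f := f) _ q1).
  move=> _ [v [w1 [w2 [k1 [k2 [-> T1 T2 K]]]]]] /=; rd; rewrite -ltnNge => hv.
  exists 150%N; apply: runs_final => //.
  rewrite /replay_step !final_seq !final_pull /=; rd; split; last first.
    by rewrite /f /=; rd; rewrite (trunc_log2S hv); lia.
  eexists; eexists; eexists; exists k1, k2; split.
  - by rewrite (@upd_comm _ _ 6%N 5%N) // !upd_upd.
  - exact: tournament_from_up hv T1.
  - exact: tournament_from_up hv T2.
  - exact: K.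
have [v [w1 [w2 [k1 [k2 [-> [_ hv _] _ _]]]]]] := q1.
rewrite /f /=; rd.
have : (trunc_log 2 v <= trunc_log 2 (r + r))%N by apply: leq_trunc_log; lia.
lia.
Qed.

End SetRow.
(** * Sums over the leaves of a tree *)

(** The pair [j], [i] stands for the child of node [j] by letter [i]. *)
Definition gsum (R : realType) (r : nat) (p b : nat -> nat)
    (phi : nat -> nat -> R) : R :=
  \sum_(i < r) \sum_(p i <= j < b i) phi j i.

Section Gsum.
Variables (R : realType) (r : nat).
Implicit Types (p b q : nat -> nat) (phi psi : nat -> nat -> R).

Lemma ler_gsum p b phi psi :
  (forall i j, (i < r)%N -> (p i <= j < b i)%N -> phi j i <= psi j i) ->
  gsum r p b phi <= gsum r p b psi.
Proof.
move=> h; apply: ler_sum => i _; rewrite big_nat [leRHS]big_nat.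
by apply: ler_sum => j hj; exact: h.
Qed.

Lemma eq_gsum p b phi psi :
  (forall i j, (i < r)%N -> (p i <= j < b i)%N -> phi j i = psi j i) ->
  gsum r p b phi = gsum r p b psi.
Proof.
by move=> h; apply: eq_bigr => i _; apply: eq_big_nat => j hj; exact: h.
Qed.

Lemma gsumD p b phi psi :
  gsum r p b (fun j i => phi j i + psi j i) = gsum r p b phi + gsum r p b psi.
Proof. by rewrite /gsum -big_split; apply: eq_bigr => i _; rewrite big_split. Qed.

Lemma gsumZ p b a phi :
  gsum r p b (fun j i => phi j i * a) = gsum r p b phi * a.
Proof. by rewrite /gsum mulr_suml; apply: eq_bigr => i _; rewrite mulr_suml. Qed.

Lemma gsum1 p b : (forall i, (i < r)%N -> (p i <= b i)%N) ->
  gsum r p b (fun _ _ => 1) + (\sum_(i < r) p i)%:R =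
  (\sum_(i < r) b i)%:R :> R.
Proof.
move=> h; rewrite !natr_sum -big_split; apply: eq_bigr => i _ /=.
by rewrite big_const_nat iter_addr_0 -natrD subnK ?h.
Qed.

Lemma gsum_cat p b q phi : (forall i, (i < r)%N -> (p i <= b i <= q i)%N) ->
  gsum r p q phi = gsum r p b phi + gsum r b q phi.
Proof.
move=> h; rewrite /gsum -big_split; apply: eq_bigr => i _ /=.
by have /andP[h1 h2] := h i (ltn_ord i); rewrite -big_cat_nat.
Qed.

(** Each side adds the old or new row that the other side contains, which avoids subtraction. *)
Lemma gsum_update p b p' b' phi phi' i0 : (i0 < r)%N ->
  (forall i, i != i0 -> p' i = p i /\ b' i = b i) ->
  (forall j i, i != i0 -> phi' j i = phi j i) ->
  gsum r p' b' phi' + \sum_(p i0 <= j < b i0) phi j i0 =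
  gsum r p b phi + \sum_(p' i0 <= j < b' i0) phi' j i0.
Proof.
move=> h e1 e2; rewrite /gsum (bigD1 (Ordinal h)) //= [in RHS](bigD1 (Ordinal h)) //=.
rewrite addrAC [RHS]addrC addrA; congr (_ + _); apply: eq_bigr => i ne.
have ne' : nat_of_ord i != i0 by apply: contraNneq ne => e; apply/eqP/val_inj.
have [-> ->] := e1 _ ne'; apply: eq_bigr => j _; exact: e2.
Qed.

Lemma gsum_add p b phi i : (i < r)%N -> (p i <= b i)%N ->
  gsum r p (upd b i (b i).+1) phi = gsum r p b phi + phi (b i) i.
Proof.
move=> hi le; have := @gsum_update p b p (upd b i (b i).+1) phi phi i hi.
rewrite upd_same big_nat_recr //= => E.
apply: (addIr (\sum_(p i <= j < b i) phi j i)); rewrite E //; last first.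
  by move=> k ne; rewrite upd_other.
by rewrite addrA addrAC.
Qed.

Lemma gsum_remove p b phi i : (i < r)%N -> (p i < b i)%N ->
  gsum r p b phi = gsum r p (upd b i (b i - 1)%N) phi + phi (b i - 1)%N i.
Proof.
move=> hi lt; have := @gsum_add p (upd b i (b i - 1)%N) phi i hi.
rewrite upd_same upd_upd subn1 prednK; last by lia.
by rewrite upd_id => -> //; lia.
Qed.

Lemma gsum_pop p b phi i : (i < r)%N -> (p i < b i)%N ->
  gsum r p b phi = gsum r (upd p i (p i).+1) b phi + phi (p i) i.
Proof.
move=> hi lt; have := @gsum_update p b (upd p i (p i).+1) b phi phi i hi.
rewrite upd_same big_ltn //= => E.
apply: (addIr (\sum_((p i).+1 <= j < b i) phi j i)); rewrite -E //; last first.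
  by move=> k ne; rewrite upd_other.
by rewrite addrA.
Qed.

Lemma gsum_set p b phi phi' j0 i0 : (i0 < r)%N -> (p i0 <= j0 < b i0)%N ->
  (forall j i, (j != j0) || (i != i0) -> phi' j i = phi j i) ->
  gsum r p b phi' = gsum r p b phi + (phi' j0 i0 - phi j0 i0).
Proof.
move=> hi hj e; have := @gsum_update p b p b phi phi' i0 hi.
have cut f : \sum_(p i0 <= j < b i0) f j i0 = f j0 i0 +
    (\sum_(p i0 <= j < j0) f j i0 + \sum_(j0.+1 <= j < b i0) f j i0) :> R.
  have /andP[h1 h2] := hj.
  rewrite (@big_cat_nat _ _ _ j0) //=; last exact: ltnW.
  have -> : \sum_(j0 <= j < b i0) f j i0 =
      f j0 i0 + \sum_(j0.+1 <= j < b i0) f j i0 by exact: big_ltn.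
  exact: addrCA.
rewrite !cut.
rewrite (eq_big_nat _ _ (F1 := fun j => phi' j i0) (F2 := fun j => phi j i0)); last first.
  by move=> j hj'; apply: e; rewrite (_ : j != j0) //; lia.
rewrite [in RHS](eq_big_nat _ _ (F1 := fun j => phi' j i0) (F2 := fun j => phi j i0)); last first.
  by move=> j hj'; apply: e; rewrite (_ : j != j0) //; lia.
have e' j i : i != i0 -> phi' j i = phi j i by move=> ne; apply: e; rewrite ne orbT.
by move=> /(_ (fun _ _ => conj erefl erefl) e'); lra.
Qed.

Lemma gsum_nodes p N phi : (forall i, (i < r)%N -> (p i <= N)%N) ->
  gsum r p (fun=> N.+1) phi = gsum r p (fun=> N) phi + \sum_(i < r) phi N i.
Proof.
move=> h; rewrite /gsum -big_split; apply: eq_bigr => i _ /=.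
by rewrite big_nat_recr //= h.
Qed.

End Gsum.

(** * Lower bounds *)

(** [Empty] marks a position without codewords, since a code need not use every letter at a node.
    Branches at indices from r on are ignored by [leaves] and [cost], and a [Node] may have no leaf
    at all. *)
Inductive ctree := Empty | Leaf | Node of (nat -> ctree).

Definition is_node (t : ctree) : bool := if t is Node _ then true else false.

Section Trees.
Variables (R : realType) (r : nat) (c : nat -> R).
Implicit Types (t : ctree) (v tau : R) (p b : nat -> nat) (dep : nat -> R).

Fixpoint leaves t : nat :=
  match t with
  | Empty => 0
  | Leaf => 1
  | Node f => \sum_(i < r) leaves (f i)
  end.

Fixpoint cost t : R :=
  match t with
  | Empty | Leaf => 0
  | Node f => \sum_(i < r) ((leaves (f i))%:R * c i + cost (f i))
  end.

Definition cost_at v t : R := (leaves t)%:R * v + cost t.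

Hypothesis c_ge0 : forall i, (i < r)%N -> 0 <= c i.
Hypothesis c_mono : forall i j, (i <= j)%N -> (j < r)%N -> c i <= c j.

Lemma cost_ge0 t : 0 <= cost t.
Proof.
elim: t => //= f IH; apply: sumr_ge0 => i _; apply: addr_ge0 => //.
by apply: mulr_ge0 => //; exact: c_ge0.
Qed.

Lemma cost_at_node v f :
  cost_at v (Node f) = \sum_(i < r) cost_at (v + c i) (f i).
Proof.
rewrite /cost_at /= natr_sum mulr_suml -big_split; apply: eq_bigr => i _ /=.
by rewrite mulrDr addrA.
Qed.

(* Every leaf is charged tau. When v + c 1 >= tau, only the descendants of the
   first child of the root can gain. *)
Definition pays v tau t : Prop :=
  Num.min (v - tau) 0 <= cost_at v t - (leaves t)%:R * tau.

Lemma pays_small v tau t :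
  (is_node t -> leaves t = 0%N) -> pays v tau t.
Proof.
rewrite /pays /cost_at; case: t => [_|_|f /(_ isT) ->] /=.
- by rewrite mul0r add0r mul0r subr0 ge_min lexx orbT.
- by rewrite !mul1r addr0 ge_min lexx.
- rewrite !mul0r add0r subr0 ge_min.
  by rewrite (cost_ge0 (Node f)) orbT.
Qed.

(** Induction on the tree. The first child is at depth v + c 0 >= v, so by induction it loses no
    more than the bound allowed at v. Every other child is at depth at least v + c 1 >= tau, where
    the induction bound is 0. The hypothesis passes to the children because depths only increase. *)
Lemma pays_deep v tau t : (1 < r)%N -> tau <= v + c 1 -> pays v tau t.
Proof.
move=> r_gt1; elim: t v => [v _|v _|f IH v le]; [exact: pays_small|exact: pays_small|].
rewrite /pays cost_at_node /= natr_sum mulr_suml -sumrB.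
have h i : (i < r)%N ->
    Num.min (v + c i - tau) 0 <= cost_at (v + c i) (f i) - (leaves (f i))%:R * tau.
  move=> hi; apply: IH; apply: le_trans le _.
  by rewrite -addrA lerD2l lerDr c_ge0.
case: r r_gt1 c_ge0 c_mono h => // k r_gt1' c0 cm h; rewrite big_ord_recl.
apply: (@le_trans _ _ (Num.min (v + c 0 - tau) 0 + 0)).
  have := c0 0%N isT; rewrite addr0 !le_min ge_min => c00; apply/andP; split.
    by apply/orP; left; lra.
  by rewrite ge_min lexx orbT.
apply: lerD; first exact: h.
apply: sumr_ge0 => i _; apply: le_trans (h _ (ltn_ord _)).
rewrite le_min lexx andbT.
have := cm 1%N (lift ord0 i) isT (ltn_ord _); lra.
Qed.

Definition frontier_value dep (j i : nat) : R := dep j + c i.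

(* The leaves of a code are distributed below the frontier, at total cost at
   most X. *)
Definition distributes (n N : nat) dep p (t : nat -> nat -> ctree) X : Prop :=
  gsum r p (fun=> N) (fun j i => (leaves (t j i))%:R) = n%:R :> R /\
  gsum r p (fun=> N)
    (fun j i => cost_at (frontier_value dep j i) (t j i)) <= X.

(** Weak duality with price tau. The selected positions are at depth at most tau and the others at
    least tau, so the selected leaves attain the sum of min(value - tau, 0) over the whole frontier.
    By [pays] the code is at least that sum, and n tau cancels because both sides have n leaves. *)
Lemma distributes_paid n N dep p b (t : nat -> nat -> ctree) X tau :
  (forall i, (i < r)%N -> (p i <= b i <= N)%N) ->
  gsum r p b (fun _ _ => 1) = n%:R :> R ->
  (forall i j, (i < r)%N -> (p i <= j < b i)%N ->
     frontier_value dep j i <= tau) ->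
  (forall i j, (i < r)%N -> (b i <= j < N)%N ->
     tau <= frontier_value dep j i) ->
  (forall i j, (i < r)%N -> (p i <= j < N)%N ->
     pays (frontier_value dep j i) tau (t j i)) ->
  distributes n N dep p t X -> gsum r p b (frontier_value dep) <= X.
Proof.
move=> hpb hn hT hF ht [tn tX]; apply: le_trans tX.
have E1 : gsum r p (fun=> N) (fun j i => cost_at (frontier_value dep j i) (t j i)
    + (leaves (t j i))%:R * - tau) =
    gsum r p (fun=> N) (fun j i => cost_at (frontier_value dep j i) (t j i))
    - n%:R * tau.
  by rewrite gsumD gsumZ tn mulrN.
have E2 : gsum r p b (fun j i => frontier_value dep j i + 1 * - tau) =
    gsum r p b (frontier_value dep) - n%:R * tau.
  by rewrite gsumD gsumZ hn mulrN.
rewrite -(lerD2r (- (n%:R * tau))) -E1 -E2.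
apply: (@le_trans _ _ (gsum r p (fun=> N)
   (fun j i => Num.min (frontier_value dep j i - tau) 0))); last first.
  by apply: ler_gsum => i j hi hj; rewrite mulrN; exact: ht.
rewrite (@gsum_cat _ _ p b (fun=> N)) // -[leLHS]addr0; apply: lerD.
  apply: ler_gsum => i j hi hj; rewrite mul1r le_min lexx /= subr_le0.
  exact: hT.
apply: sumr_ge0 => i _; rewrite big_nat; apply: sumr_ge0 => j hj; rewrite le_min lexx andbT subr_ge0.
exact: hF.
Qed.

(** Exchanging the two subtrees changes the cost by the difference of their leaf numbers times the
    difference of their depths. A tree that is not a [Node] has at most one leaf and the other has
    at least one, so moving the latter up costs nothing. *)
Lemma distributes_swap n N dep p (t : nat -> nat -> ctree) X ja ia jx ix f :
  (ia < r)%N -> (p ia <= ja < N)%N -> (ix < r)%N -> (p ix <= jx < N)%N ->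
  ~~ is_node (t ja ia) ->
  t jx ix = Node f -> (0 < leaves (t jx ix))%N ->
  frontier_value dep ja ia <= frontier_value dep jx ix ->
  distributes n N dep p t X ->
  exists t' : nat -> nat -> ctree, t' ja ia = Node f /\ distributes n N dep p t' X.
Proof.
move=> hia hja hix hjx ta tx lx le [tn tX].
have ne : ((ja == jx) && (ia == ix)) = false.
  by apply/negP => /andP[/eqP e1 /eqP e2]; rewrite e1 e2 tx in ta.
pose t1 j i := if (j == ja) && (i == ia) then t jx ix else t j i.
pose t2 j i := if (j == jx) && (i == ix) then t ja ia else t1 j i.
have nb (b1 b2 : bool) : ~~ b1 || ~~ b2 -> (b1 && b2) = false.
  by case: b1; case: b2.
have sum (phi : nat -> nat -> ctree -> R) :
    gsum r p (fun=> N) (fun j i => phi j i (t2 j i)) =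
    gsum r p (fun=> N) (fun j i => phi j i (t j i)) +
    (phi ja ia (t jx ix) - phi ja ia (t ja ia)) +
    (phi jx ix (t ja ia) - phi jx ix (t jx ix)).
  rewrite (@gsum_set _ _ _ _ (fun j i => phi j i (t1 j i)) _ jx ix) //; last first.
    by move=> j i h; rewrite /t2 nb.
  rewrite (@gsum_set _ _ _ _ (fun j i => phi j i (t j i)) _ ja ia) //; last first.
    by move=> j i h; rewrite /t1 nb.
  by rewrite /t2 !eqxx /= /t1 !eqxx /= [jx == _]eq_sym [ix == _]eq_sym ne.
have la : (leaves (t ja ia) <= 1)%N by case: (t ja ia) ta.
have ca : cost (t ja ia) = 0 by case: (t ja ia) ta.
exists t2; split; first by rewrite /t2 ne /t1 !eqxx.
split.
  by rewrite (sum (fun _ _ t => (leaves t)%:R)) tn; lra.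
rewrite (sum (fun j i t => cost_at (frontier_value dep j i) t)); apply: le_trans tX.
rewrite -addrA gerDl /cost_at ca.
have h : (leaves (t ja ia))%:R <= (leaves (t jx ix))%:R :> R by rewrite ler_nat; lia.
have : 0 <= ((leaves (t jx ix))%:R - (leaves (t ja ia))%:R) *
    (frontier_value dep jx ix - frontier_value dep ja ia).
  by apply: mulr_ge0; rewrite subr_ge0.
rewrite mulrBl !mulrBr; lra.
Qed.

(** The position becomes node N, and the branches of its subtree become the row of children of N in
    the new frontier; neither sum changes. *)
Lemma distributes_expand n N dep p (t : nat -> nat -> ctree) X i f :
  (forall k, (k < r)%N -> (p k <= N)%N) ->
  (i < r)%N -> (p i < N)%N -> t (p i) i = Node f ->
  dep N = frontier_value dep (p i) i ->
  distributes n N dep p t X ->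
  exists t' : nat -> nat -> ctree, distributes n N.+1 dep (upd p i (p i).+1) t' X.
Proof.
move=> hp hi lt ti dN [tn tX].
exists (fun j k => if j == N then f k else t j k).
have hp' k : (k < r)%N -> (upd p i (p i).+1 k <= N)%N.
  by move=> hk; rewrite /upd; case: eqP => // _; exact: hp.
have sum (phi : nat -> nat -> ctree -> R) :
    \sum_(k < r) phi N k (f k) = phi (p i) i (Node f) ->
    gsum r (upd p i (p i).+1) (fun=> N.+1)
      (fun j k => phi j k (if j == N then f k else t j k)) =
    gsum r p (fun=> N) (fun j k => phi j k (t j k)).
  move=> e; rewrite gsum_nodes // [RHS](@gsum_pop _ _ _ _ _ i) // ti -e.
  congr (_ + _); last by apply: eq_bigr => k _; rewrite eqxx.
  by apply: eq_gsum => k j hk hj; rewrite (_ : j == N = false) //; lia.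
split.
  by rewrite (sum (fun _ _ t => (leaves t)%:R)) //= natr_sum.
rewrite (sum (fun j k t => cost_at (frontier_value dep j k) t)) //=.
by rewrite cost_at_node -dN.
Qed.

End Trees.
(** Induction on the maximal word length. If the empty word is present, prefix-freeness makes it the
    only word and the tree is a [Leaf]; otherwise the words are split by first letter and the tails
    [si i] are again prefix-free. *)
Lemma code_ctree (R : realType) (r : nat) (c : 'I_r -> R) (cn : nat -> R)
    (s : seq (word r)) :
  (forall i : 'I_r, cn i = c i) -> uniq s ->
  (forall u v, u \in s -> v \in s -> prefix u v -> u = v) ->
  exists t, leaves r t = size s /\ cost r cn t = \sum_(w <- s) word_length c w.
Proof.
move=> hc; have [k] := ubnP (\max_(w <- s) (size w).+1)%N.
elim: k s => // k IH s hk us pf.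
have hs w : w \in s -> (size w < k)%N.
  by move=> ws; rewrite -ltnS; apply: leq_trans hk; rewrite ltnS; apply: (@leq_bigmax_seq _ s xpredT (fun w => (size w).+1)).
have [->|[w0 hsome]] : s = [::] \/ exists w, w \in s.
  by case: (s) => [|w s']; [left|right; exists w; rewrite mem_head].
  by exists Empty; rewrite big_nil.
have k0 : (0 < k)%N by have := hs _ hsome; lia.
have [|ne] := boolP ([::] \in s).
  case: s hk us pf hs hsome => // w s hk us pf hs _ hn.
  have all0 v : v \in w :: s -> v = [::].
    by move=> vs; rewrite -(pf [::] v) // prefix0s.
  case: s hk us pf hs hn all0 => [|w' s] hk us pf hs hn all0.
    exists Leaf => /=; split => //.
    by rewrite big_seq1 (all0 w) ?mem_head // /word_length big_nil.
  move: us; rewrite /= inE (all0 w) ?mem_head // (all0 w') ?eqxx //.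
  by rewrite !inE eqxx orbT.
pose si (i : 'I_r) := [seq behead w | w <- s & ohead w == Some i].
have siP i w : w \in si i -> i :: w \in s.
  by case/mapP => -[|i' w']; rewrite mem_filter //= => /andP[/eqP[->]] + ->.
have part (T : nmodType) (F : word r -> T) :
    \sum_(w <- s) F w = \sum_(i < r) \sum_(w <- si i) F (i :: w).
  under [RHS]eq_bigr => i _ do rewrite big_map big_filter big_mkcond.
  rewrite exchange_big /=; apply: eq_big_seq => -[|i w]; first by rewrite (negbTE ne).
  move=> _; rewrite -big_mkcond /= (big_pred1 i) //.
have IHi i : exists t, leaves r t = size (si i) /\
    cost r cn t = \sum_(w <- si i) word_length c w.
  apply: IH.
  - rewrite -[k]prednK // ltnS; apply/bigmax_leqP_seq => w /siP/hs /=.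
    by rewrite -[in (_ < k)%N](prednK k0).
  - rewrite map_inj_in_uniq ?filter_uniq // => -[|a u] [|a' v]; rewrite !mem_filter //=.
    by move=> /andP[/eqP[->] _] /andP[/eqP[->] _] ->.
  - move=> u v /siP us' /siP vs' puv.
    have : prefix (i :: u) (i :: v) by rewrite prefix_cons eqxx.
    by move=> /(pf _ _ us' vs')[].
have [g hg] := fin_all_exists IHi.
exists (Node (fun j => if insub j is Some i then g i else Empty)) => /=.
have gE (i : 'I_r) : (if insub (nat_of_ord i) is Some i then g i else Empty) = g i.
  by rewrite valK.
split.
  rewrite -sum1_size part; apply: eq_bigr => i _; rewrite gE.
  by have [-> _] := hg i; rewrite sum1_size.
rewrite part; apply: eq_bigr => i _; rewrite gE; have [-> ->] := hg i.
rewrite /word_length; under [RHS]eq_bigr do rewrite big_cons.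
by rewrite big_split /= big_const_seq count_predT iter_addr_0 hc mulr_natl.
Qed.

(** * The invariant of the search *)

Lemma sum_upd_nat (r : nat) (f : nat -> nat) k x : (k < r)%N ->
  (\sum_(l < r) upd f k x l + f k = \sum_(l < r) f l + x)%N.
Proof.
move=> hk; rewrite (bigD1 (Ordinal hk)) //= [in RHS](bigD1 (Ordinal hk)) //=.
rewrite upd_same (eq_bigr (fun l : 'I_r => f l)); first lia.
move=> l ne; rewrite upd_other //; apply: contraNneq ne => e; exact/eqP/val_inj.
Qed.

Section Invariant.
Variables (R : realType) (r : nat) (c : nat -> R).
Implicit Types (n N K cnt i j k : nat) (p b par lett : nat -> nat).
Implicit Types (dep : nat -> R) (X : R).

(* Nodes 0, ..., N-1 are numbered; those below K may have children. *)
Record numbered K N dep par lett p b : Prop := Numbered {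
  nb_bound : (K <= N)%N && (0 < N)%N;
  nb_root : dep 0%N = 0;
  nb_node : forall v, (0 < v < N)%N ->
    [/\ (par v < v)%N, (par v < K)%N, (lett v < r)%N,
        dep v = dep (par v) + c (lett v) & (par v < p (lett v))%N];
  nb_inj : forall v v', (0 < v < N)%N -> (0 < v' < N)%N ->
    par v = par v' -> lett v = lett v' -> v = v';
  nb_rows : forall i, (p i <= b i <= if i < r then K else 0)%N
}.

Lemma numbered_ext K N dep par lett p b dep' par' lett' :
  (forall v, (v < N)%N ->
     [/\ dep' v = dep v, par' v = par v & lett' v = lett v]) ->
  numbered K N dep par lett p b -> numbered K N dep' par' lett' p b.
Proof.
move=> e [h1 h2 h3 h4 h5]; split => //.
- by have [-> _ _] := e 0%N ltac:(lia).
- move=> v hv; have [-> -> ->] := e v ltac:(lia).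
  by have [a1 a2 a3 a4 a5] := h3 v hv; have [-> _ _] := e (par v) ltac:(lia).
- move=> v v' hv hv'; have [_ -> ->] := e v ltac:(lia).
  by have [_ -> ->] := e v' ltac:(lia); exact: h4.
Qed.

Lemma numbered_rows K N dep par lett p b b' :
  (forall i, (p i <= b' i <= if i < r then K else 0)%N) ->
  numbered K N dep par lett p b -> numbered K N dep par lett p b'.
Proof. by move=> h [h1 h2 h3 h4 h5]; split. Qed.

(** All earlier nodes with letter i have a parent below [p i], by the last clause of [nb_node]; this
    makes the new pair of parent and letter fresh. K is kept apart from N because terminals are
    numbered by the same operation without becoming possible parents. *)
Lemma numbered_pop K N dep par lett p b i : (p i < b i)%N ->
  numbered K N dep par lett p b ->
  numbered K N.+1 (upd dep N (frontier_value c dep (p i) i))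
    (upd par N (p i)) (upd lett N i) (upd p i (p i).+1) b.
Proof.
move=> lt [h1 h2 h3 h4 h5].
have hi := h5 i; have ir : (i < r)%N by move: hi; case: ifP => //; lia.
rewrite ir in hi.
split.
- lia.
- by rewrite upd_other //; lia.
- move=> v hv; have [->|ne] := eqVneq v N.
    rewrite !upd_same; split => //; try lia.
    by rewrite upd_other //; lia.
  have [|a1 a2 a3 a4 a5] := h3 v; first by move/eqP: ne; lia.
  rewrite !(upd_other _ _ ne) upd_other; last by lia.
  split => //; rewrite /upd; case: eqP => [e|//]; rewrite -e; lia.
- move=> v v' hv hv'; have [->|ne] := eqVneq v N; have [->|ne'] := eqVneq v' N => //.
  + rewrite !upd_same !upd_other // => e1 e2.
    have [|_ _ _ _] := h3 v'; first by move/eqP: ne'; lia.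
    by rewrite -e1 -e2 ltnn.
  + rewrite !upd_same !upd_other // => e1 e2.
    have [|_ _ _ _] := h3 v; first by move/eqP: ne; lia.
    by rewrite e1 e2 ltnn.
  + by rewrite !upd_other //; apply: h4; move/eqP: ne ne' => ne /eqP; lia.
- by move=> j; have := h5 j; rewrite /upd; case: eqP => // ->; lia.
Qed.

Hypothesis c_ge0 : forall i, (i < r)%N -> 0 <= c i.
Hypothesis c_mono : forall i j, (i <= j)%N -> (j < r)%N -> c i <= c j.

Local Notation value := (frontier_value c).

(* While the children of node N-1 are being generated, those by the letters
   below i are part of the frontier. *)
Definition row_end N i k : nat := if (k < i)%N then N else N.-1.

(** The tree has N internal nodes and [cnt] leaves. [sl_p] holds because each internal node except
    the root was taken once from some row; [sl_last] keeps depths nondecreasing when the next node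
    is appended; [sl_order] says that the leaves kept are shallowest in the frontier. *)
Record selection N cnt i dep par lett p b X : Prop := Selection {
  sl_nodes : numbered N N dep par lett p b;
  sl_mono : forall j k, (j <= k < N)%N -> dep j <= dep k;
  sl_p : (\sum_(k < r) p k).+1 = N;
  sl_b : (\sum_(k < r) b k = cnt + \sum_(k < r) p k)%N;
  sl_cost : X = gsum r p b (value dep);
  sl_last : forall k, (k < r)%N -> (p k < N)%N -> dep N.-1 <= value dep (p k) k;
  sl_end : forall k, (k < r)%N -> (b k <= row_end N i k)%N;
  sl_order : forall k j k' j', (k < r)%N -> (p k <= j < b k)%N ->
    (k' < r)%N -> (b k' <= j' < row_end N i k')%N ->
    value dep j k <= value dep j' k'
}.

Definition some_leaf dep p b (P : R -> Prop) : Prop :=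
  exists k j, [/\ (k < r)%N, (p k <= j < b k)%N & P (value dep j k)].

Definition all_leaves dep p b (P : R -> Prop) : Prop :=
  forall k j, (k < r)%N -> (p k <= j < b k)%N -> P (value dep j k).

Definition rest N i dep b (P : R -> Prop) : Prop :=
  forall k j, (k < r)%N -> (b k <= j < row_end N i k)%N -> P (value dep j k).

(* The second case occurs when node N-1 has just become internal. *)
Definition filled n N cnt i dep b : Prop :=
  (cnt = n \/ forall k, (k < r)%N -> b k = row_end N i k) \/
  [/\ i = 0%N, cnt.+1 = n & rest N i dep b (fun x => dep N.-1 + c 0 < x)].

(* This guarantees that node N-1 gets at least two children. *)
Definition two_children n N cnt i dep p b : Prop := (i < 2)%N ->
  (cnt < n + i)%N /\ ((cnt + 2 <= n + i)%N \/
  some_leaf dep p b (fun x => dep N.-1 + c 1 < x)).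

Definition can_add n N cnt i dep p b : Prop :=
  (cnt < n)%N \/ some_leaf dep p b (fun x => dep N.-1 + c i < x).

Section Add.
Variables (n N cnt i : nat) (dep : nat -> R) (par lett p b : nat -> nat) (X : R).
Hypothesis sel : selection N cnt i dep par lett p b X.

Lemma N_gt0 : (0 < N)%N.
Proof. by have [/nb_bound/andP[_ ->]] := sel. Qed.

(** Either a leaf deeper than the new child exists, and [sl_order] carries this over to all omitted
    positions, or leaves are missing and [filled] says what is omitted. The inequality must be
    strict for [add_row]. *)
Lemma rest_deep : (i < r)%N -> (cnt <= n)%N -> filled n N cnt i dep b ->
  can_add n N cnt i dep p b -> rest N i dep b (fun x => dep N.-1 + c i < x).
Proof.
move=> hi hn fl ca k j hk hj.
case: ca => [lt|[k' [j' [hk' hj' lt]]]]; last first.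
  by apply: (lt_le_trans lt); exact: (sl_order sel).
case: fl => [[e|e]|[e1 e2]]; [lia|by rewrite e // in hj; lia|].
by rewrite e1 => h; apply: h => //; rewrite -e1.
Qed.

Hypothesis hi : (i < r)%N.
Hypothesis deep : rest N i dep b (fun x => dep N.-1 + c i < x).

(** An omitted child of an earlier node by a letter k <= i would be no deeper than the child of the
    last node by letter i, against the strict inequality in [deep]. *)
Lemma add_row k : (k <= i)%N -> b k = row_end N i k.
Proof.
move=> hk; have kr : (k < r)%N by lia.
have := sl_end sel kr; rewrite leq_eqVlt => /orP[/eqP//|lt].
have N0 := N_gt0; have bN : (b k < N)%N by move: lt; rewrite /row_end; case: ifP; lia.
have le : dep (b k) <= dep N.-1 by apply: (sl_mono sel); lia.
have := @deep k (b k) kr; rewrite leqnn lt => /(_ isT).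
by rewrite ltNge (lerD le (c_mono hk hi)).
Qed.

Lemma add_b : b i = N.-1.
Proof. by rewrite add_row // /row_end ltnn. Qed.

(** Once the child is added, the rows of the letters 0, ..., i are complete and count N children
    each. The sum of all [b] counts internal children as well, hence equals (cnt + 1) + (N - 1).
    This is the inequality k m <= n + m behind the time bound. *)
Lemma add_count : (i.+1 * N <= cnt + N)%N.
Proof.
have := sum_upd_nat b (b i).+1 hi; rewrite (sl_b sel).
have := sl_p sel => e1 e2.
have : (\sum_(k < i.+1) N <= \sum_(k < r) upd b i (b i).+1 k)%N.
  rewrite (big_ord_widen r (fun=> N) hi) big_mkcond; apply: leq_sum => k _.
  case: ifP => // hk; rewrite /upd; case: eqP => [e|ne].
    by rewrite add_b; have := N_gt0; lia.
  by rewrite add_row ?/row_end; [case: ifP; lia|lia].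
rewrite sum_nat_const card_ord; lia.
Qed.

Lemma selection_add : selection N cnt.+1 i.+1 dep par lett p
  (upd b i (b i).+1) (X + value dep (b i) i).
Proof.
have N0 := N_gt0; have bi := add_b; have bi' : (b i).+1 = N by lia.
case: sel => h1 h2 h3 h4 h5 h6 h7 h8.
have pb k : (p k <= b k)%N by have /andP[] := nb_rows h1 k.
split => //.
- apply: (numbered_rows _ h1) => k; have := nb_rows h1 k.
  by rewrite /upd; case: eqP => // ->; rewrite hi; lia.
- by have := sum_upd_nat b (b i).+1 hi; lia.
- by rewrite gsum_add // -h5.
- move=> k hk; rewrite /upd /row_end; case: eqP => [->|]; first by rewrite ltnS leqnn bi'.
  by have := h7 k hk; rewrite /row_end; do !case: ifP; lia.
- move=> k j k' j' hk hj hk' hj'.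
  have hr : (b k' <= j' < row_end N i k')%N.
    move: hj'; rewrite /upd /row_end; case: eqP => [->|ne]; first by case: ifP; lia.
    by do !case: ifP; lia.
  move: hj; rewrite /upd; case: eqP => [->|ne] hj; last exact: h8.
  have [e|ne] := eqVneq j (b i); first by apply/ltW; rewrite e bi; exact: deep.
  by apply: h8 => //; move/eqP: ne; lia.
Qed.

End Add.

Lemma filled_add n N cnt i dep b : (0 < N)%N -> (cnt < n)%N ->
  b i = N.-1 -> filled n N cnt i dep b ->
  filled n N cnt.+1 i.+1 dep (upd b i (b i).+1).
Proof.
move=> N0 lt bi [[e|e]|[_ e _]]; left; [lia| |by left].
right => k hk; rewrite /upd; case: eqP => [->|ne].
  by rewrite /row_end ltnS leqnn bi; lia.
by rewrite e // /row_end; do !case: ifP; lia.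
Qed.

Lemma two_children_add n N cnt i dep p b : (cnt < n)%N ->
  two_children n N cnt i dep p b ->
  two_children n N cnt.+1 i.+1 dep p (upd b i (b i).+1).
Proof.
move=> lt h hi; have [|h1 h2] := h; first lia.
split; first lia; case: h2 => [h2|[k [j [hk hj lt']]]]; [by left; lia|right].
by exists k, j; split => //; rewrite /upd; case: eqP hj => // ->; lia.
Qed.

Lemma two_children_can_add n N cnt i dep p b : (i < 2)%N ->
  two_children n N cnt i dep p b -> can_add n N cnt i dep p b.
Proof.
move=> hi h; have [h1 h2] := h hi; rewrite /can_add.
case: i hi h1 h2 {h} => [|[|//]] hi h1 h2; first by left; lia.
by case: h2 => h2; [left; lia|right].
Qed.

Lemma selection_remove N cnt i dep par lett p b X k :
  (k < r)%N -> (p k < b k)%N ->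
  all_leaves dep p b (fun x => x <= value dep (b k - 1) k) ->
  selection N cnt.+1 i dep par lett p b X ->
  selection N cnt i dep par lett p (upd b k (b k - 1)%N)
    (X - value dep (b k - 1) k).
Proof.
move=> hk lt mx [h1 h2 h3 h4 h5 h6 h7 h8].
have le j : (upd b k (b k - 1)%N j <= b j)%N.
  by rewrite /upd; case: eqP => // ->; lia.
split => //.
- apply: (numbered_rows _ h1) => j; have := nb_rows h1 j.
  by rewrite /upd; case: eqP => // ->; rewrite hk; lia.
- by have := @sum_upd_nat r b k (b k - 1)%N hk; lia.
- by rewrite h5 (gsum_remove _ hk lt) addrK.
- by move=> j hj; apply: leq_trans (h7 j hj).
- move=> l j l' j' hl hj hl' hj'.
  have hj2 : (p l <= j < b l)%N by have := le l; lia.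
  move: hj'; rewrite /upd; case: eqP => [e|ne] hj'; last exact: h8.
  have [->|ne] := eqVneq j' (b k - 1)%N; first by rewrite e; exact: mx.
  by apply: h8 => //; rewrite e; rewrite e in hj'; move/eqP: ne; lia.
Qed.

(** Stopping at letter i turns the remaining children of the last node into omitted positions; being
    at depth at least that of the child by letter i, they respect [sl_order]. *)
Lemma selection_exit N cnt i dep par lett p b X : (i <= r)%N ->
  ((i < r)%N -> all_leaves dep p b (fun x => x <= dep N.-1 + c i)) ->
  selection N cnt i dep par lett p b X -> selection N cnt r dep par lett p b X.
Proof.
rewrite leq_eqVlt => /orP[/eqP -> //|lt] /(_ lt) h [h1 h2 h3 h4 h5 h6 h7 h8].
split => //.
- by move=> k hk; have := h7 k hk; rewrite /row_end hk; case: ifP; lia.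
move=> k j k' j' hk hj hk' hj'.
have [h9|h9] := ltnP j' (row_end N i k'); first by apply: h8 => //; lia.
move: hj' h9; rewrite /row_end hk'; case: ifP => [|hk'']; first lia.
move=> hj' h9; have -> : j' = N.-1 by lia.
apply: le_trans (h _ _ hk hj) _; rewrite lerD2l; apply: c_mono => //; lia.
Qed.

Lemma filled_frontier n N cnt dep b : (0 < r)%N -> filled n N cnt r dep b ->
  cnt = n \/ forall k, (k < r)%N -> b k = N.
Proof.
move=> r0 [[e|e]|[e _ _]]; [by left|right|lia].
by move=> k hk; rewrite e // /row_end hk.
Qed.

End Invariant.

(** * Expanding the shallowest leaf, and the stopping rule *)

Section Pop.
Variables (R : realType) (r : nat) (c : nat -> R).
Hypothesis c_ge0 : forall i, (i < r)%N -> 0 <= c i.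
Hypothesis c_mono : forall i j, (i <= j)%N -> (j < r)%N -> c i <= c j.
Hypothesis r_gt1 : (1 < r)%N.

Local Notation value := (frontier_value c).

Variables (n N cnt : nat) (dep : nat -> R) (par lett p b : nat -> nat) (X : R).
Hypothesis sel : selection r c N cnt r dep par lett p b X.

Variables i0 i1 : nat.
Hypotheses (i0_lt : (i0 < r)%N) (i0_leaf : (p i0 < b i0)%N).
Local Notation a := (value dep (p i0) i0).
Hypothesis a_min : all_leaves r c dep p b (fun x => a <= x).

Lemma row_end0 M k : row_end M.+1 0 k = M.
Proof. by []. Qed.

Lemma selection_rows k : (k < r)%N -> (p k <= b k <= N)%N.
Proof. by move=> hk; have := nb_rows (sl_nodes sel) k; rewrite hk. Qed.

Lemma selection_gsum1 : gsum r p b (fun _ _ => 1) = cnt%:R :> R.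
Proof.
apply: (@addIr _ (\sum_(i < r) p i)%:R); rewrite gsum1; last first.
  by move=> i /selection_rows/andP[].
by rewrite (sl_b sel) natrD.
Qed.

Lemma frontier_min k j : (k < r)%N -> (p k <= j < N)%N -> a <= value dep j k.
Proof.
move=> hk hj; case: (ltnP j (b k)) => h; first by apply: a_min => //; lia.
by apply: (sl_order sel) => //; [lia|rewrite /row_end hk; lia].
Qed.

Local Notation dep' := (upd dep N a).
Local Notation p' := (upd p i0 (p i0).+1).

Lemma value_pop j k : (j < N)%N -> value dep' j k = value dep j k.
Proof. by move=> h; rewrite /frontier_value upd_other //; lia. Qed.

(** The new node has the minimal depth of the whole frontier, omitted positions included, and
    [sl_last] puts it after the earlier nodes. Its own children are not yet generated, hence the
    phase 0. *)
Lemma selection_pop cnt' : cnt = cnt'.+1 ->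
  selection r c N.+1 cnt' 0 dep' (upd par N (p i0)) (upd lett N i0) p' b (X - a).
Proof.
move=> ecnt; have rows := selection_rows; have aN : dep N.-1 <= a.
  by apply: (sl_last sel) => //; have := rows i0 i0_lt; lia.
have fm := frontier_min.
case: sel => h1 h2 h3 h4 h5 h6 h7 h8.
split.
- have [g1 g2 g3 g4 g5] := numbered_pop i0_leaf h1.
  split => //; first lia.
    by move=> v /[dup] hv /g3[u1 u2 u3 u4 u5]; split => //; lia.
  by move=> i; have := g5 i; case: ifP => // _; lia.
- move=> j k hjk; have [->|nk] := eqVneq k N.
    rewrite upd_same; have [->|nj] := eqVneq j N; first by rewrite upd_same.
    rewrite upd_other //; apply: le_trans aN; apply: h2.
    by move/eqP: nj; lia.
  by rewrite !upd_other //; [apply: h2; move/eqP: nk; lia|move/eqP: nk; lia].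
- have := sum_upd_nat p (p i0).+1 i0_lt; lia.
- have := sum_upd_nat p (p i0).+1 i0_lt; lia.
- rewrite h5 (gsum_pop _ i0_lt i0_leaf) addrK; apply: eq_gsum => k j hk hj.
  by rewrite value_pop //; have := rows k hk; lia.
- move=> k hk lt /=; rewrite upd_same /frontier_value.
  (* The row of [i0] may have advanced to node N itself, whose children are no shallower than N. *)
  have [->|ne] := eqVneq (p' k) N; first by rewrite upd_same lerDl c_ge0.
  rewrite upd_other //; apply: fm => //.
  move/eqP: ne lt; rewrite /upd; case: eqP => [->|_]; lia.
- by move=> k /rows; rewrite row_end0; lia.
move=> k j k' j' hk hj hk' hj'.
have hk2 := rows k hk; rewrite !value_pop; try by move: hj'; rewrite row_end0; lia.
apply: h8 => //; last by rewrite /row_end hk'; move: hj'; rewrite row_end0; lia.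
by move: hj; rewrite /upd; case: eqP => [->|]; lia.
Qed.

Hypothesis fil : filled r c n N cnt r dep b.
Hypothesis cnt_le : (cnt <= n)%N.

Section Continue.
Hypothesis go : (cnt < n)%N \/ some_leaf r c dep p b (fun x => a + c 1 < x).

(** If n leaves were present, the expansion leaves n - 1 of them. The leaf deeper than a + c 1 then
    forces every omitted position to be deeper than the first child of the new node, which is the
    second case of [filled]. *)
Lemma filled_pop cnt' : cnt = cnt'.+1 -> filled r c n N.+1 cnt' 0 dep' b.
Proof.
move=> ecnt; case: (filled_frontier (ltnW r_gt1) fil) => [e|e]; last first.
  by left; right => k hk; rewrite e.
right; split => //; first lia.
move=> k j hk hj; rewrite value_pop; last by move: hj; rewrite row_end0; lia.
rewrite /= upd_same; case: go => [|[k' [j' [hk' hj' lt]]]]; first lia.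
have := c_mono (leq0n 1) r_gt1; rewrite -(lerD2l a) => le.
apply: le_lt_trans le (lt_le_trans lt _); apply: (sl_order sel) => //.
by move: hj; rewrite row_end0 /row_end hk; lia.
Qed.

Lemma two_children_pop cnt' : cnt = cnt'.+1 ->
  two_children r c n N.+1 cnt' 0 dep' p' b.
Proof.
move=> ecnt _; split; first lia.
case: go => [|[k [j [hk hj lt]]]]; [by left; lia|right].
exists k, j; rewrite /= upd_same value_pop; last by have := selection_rows hk; lia.
split => //; rewrite /upd; case: eqP => // ek; subst k.
(* The deep leaf is not the expanded one, because a + c 1 < a is impossible; so it is still a leaf
   afterwards. *)
suff /eqP: j != p i0 by lia.
apply: contraTneq lt => ->; rewrite -leNgt lerDl; exact: c_ge0.
Qed.

End Continue.

Variable B : ctree -> Prop.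
Hypothesis i1_lt : (i1 < r)%N.
Hypothesis i1_leaf : (p i1 < b i1)%N.
Local Notation m := (value dep (b i1 - 1) i1).
Hypothesis m_max : all_leaves r c dep p b (fun x => x <= m).
Hypothesis best : cnt = n -> forall t0, X <= cost r c t0 -> B t0.

(* Every code with n codewords either satisfies B, or is no better than some
   tree in which the nodes 0, ..., N-1 are internal. *)
Definition undecided (N : nat) dep p : Prop :=
  forall t0, leaves r t0 = n -> B t0 \/
    exists t, distributes r c n N dep p t (cost r c t0).

Lemma rest_max k j : (k < r)%N -> (b k <= j < N)%N -> m <= value dep j k.
Proof.
move=> hk hj; apply: (sl_order sel) => //; first lia.
by rewrite /row_end hk.
Qed.

Lemma best_paid t t0 : cnt = n ->
  (forall i j, (i < r)%N -> (p i <= j < N)%N -> pays r c (value dep j i) m (t j i)) ->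
  distributes r c n N dep p t (cost r c t0) -> B t0.
Proof.
move=> ecnt hp ht; apply: best => //; rewrite (sl_cost sel).
apply: distributes_paid (m_max) rest_max hp ht.
  exact: selection_rows.
by rewrite selection_gsum1 ecnt.
Qed.

(** Every frontier position is at depth at least a, so its second child would be at depth at least
    m; [pays_deep] then applies everywhere with price m. *)
Lemma undecided_stop : cnt = n -> m <= a + c 1 ->
  undecided N dep p -> forall t0, leaves r t0 = n -> B t0.
Proof.
move=> ecnt le un t0 /un[//|[t ht]].
apply: best_paid ht => // i j hi hj; apply: pays_deep => //.
by apply: le_trans le _; rewrite lerD2r frontier_min.
Qed.

(** If the code branches at the shallowest leaf, that position is expanded; if it branches elsewhere
    with a codeword below, a swap brings the branching there first. Otherwise each frontier position
    carries at most one codeword: with n leaves the current tree is at least as good, and with fewer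
    leaves the whole frontier is too small to hold n codewords. *)
Lemma undecided_pop : undecided N dep p -> undecided N.+1 dep' p'.
Proof.
move=> un t0 ht0; case: (un t0 ht0) => [|[t ht]]; first by left.
have pN : (p i0 < N)%N by have := selection_rows i0_lt; lia.
have ext q t1 Y : distributes r c n N dep q t1 Y -> distributes r c n N dep' q t1 Y.
  case=> h1 h2; split => //; apply: le_trans h2; apply: ler_gsum => i j hi hj.
  by rewrite value_pop //; lia.
have pop t1 f : t1 (p i0) i0 = Node f ->
    distributes r c n N dep p t1 (cost r c t0) ->
    exists t', distributes r c n N.+1 dep' p' t' (cost r c t0).
  move=> t1f /ext h; apply: (distributes_expand _ i0_lt pN t1f _ h).
    by move=> k /selection_rows; lia.
  by rewrite upd_same value_pop.
have [[f ta]|nf] := EM (exists f, t (p i0) i0 = Node f).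
  by right; exact: pop ta ht.
have ta : ~~ is_node (t (p i0) i0).
  by case e: (t (p i0) i0) => [| |f] //; case: nf; exists f.
have [[k [j [hk hj [f [tf lf]]]]]|no] := EM (exists k j, [/\ (k < r)%N,
    (p k <= j < N)%N & exists f, t j k = Node f /\ (0 < leaves r (t j k))%N]).
  have h0 : (p i0 <= p i0 < N)%N by rewrite leqnn.
  have [t' [t'f ht']] :=
    distributes_swap i0_lt h0 hk hj ta tf lf (frontier_min hk hj) ht.
  by right; exact: pop t'f ht'.
have small i j : (i < r)%N -> (p i <= j < N)%N ->
    is_node (t j i) -> leaves r (t j i) = 0%N.
  move=> hi hj; case tji: (t j i) => [| |f] // _; apply/eqP.
  rewrite -leqn0 leqNgt; apply/negP => h; apply: no.
  by exists i, j; split => //; exists f; rewrite tji.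
have [ecnt|ncnt] := eqVneq cnt n.
  left; apply: best_paid ht => // i j hi hj.
  by apply: pays_small => //; exact: small.
case: (filled_frontier (ltnW r_gt1) fil) => [/eqP|e]; first by rewrite (negbTE ncnt).
case: ht => h _; have : (n%:R : R) <= cnt%:R.
  rewrite -h -selection_gsum1.
  rewrite [leRHS](_ : _ = gsum r p (fun=> N) (fun _ _ => 1)).
    apply: ler_gsum => i j hi hj; have := small i j hi hj.
    by case: (t j i) => [| |f] //= h'; rewrite ?h' ?ler01.
  by apply: eq_bigr => i _; rewrite e.
by rewrite ler_nat; move/eqP: ncnt; lia.
Qed.

End Pop.

(** * The search program: logged moves, growth, expansion, undoing and output *)

Definition push_row : cmd :=
  let k := IVar v_log in
  ISetArr a_lrow k (IVar v_row) ;;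
  ISetArr a_lp k (IArr a_p (IVar v_row)) ;;
  ISetArr a_lb k (IArr a_b (IVar v_row)) ;;
  ISetVar v_log (IAdd k (IConst 1)).

Definition move_row : cmd := push_row ;; set_row.

Definition min_row : iexpr := ISub (IArr a_min (IConst 1)) (IConst 1).
Definition max_row : iexpr := ISub (IArr a_max (IConst 1)) (IConst 1).
Definition max_depth : rexpr := RSub (RCast (IConst 0)) (RArr a_kmax max_row).

(* The depth of the child of the last internal node by the letter in v_i. *)
Definition child_depth : rexpr :=
  RAdd (RArr a_dep (ISub (IVar v_nodes) (IConst 1))) (RArr a_c (IVar v_i)).

Definition add_child_prelude : cmd :=
  ISetVar v_row (IVar v_i) ;;
  ISetVar v_p (IArr a_p (IVar v_i)) ;;
  ISetVar v_b (IAdd (IArr a_b (IVar v_i)) (IConst 1)) ;;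
  RSetVar x_cost (RAdd (RVar x_cost) child_depth) ;;
  ISetVar v_cnt (IAdd (IVar v_cnt) (IConst 1)).

(** Keys in [a_kmax] are negated depths, so adding the key to the cost subtracts the depth of the
    leaf removed. *)
Definition trim_prelude : cmd :=
  ISetVar v_row max_row ;;
  ISetVar v_p (IArr a_p (IVar v_row)) ;;
  ISetVar v_b (ISub (IArr a_b (IVar v_row)) (IConst 1)) ;;
  RSetVar x_cost (RAdd (RVar x_cost) (RArr a_kmax (IVar v_row))) ;;
  ISetVar v_cnt (ISub (IVar v_cnt) (IConst 1)).

Definition grow_step : cmd :=
  (add_child_prelude ;; move_row) ;;
  If (BIle (IVar v_cnt) (IVar v_n)) Skip (trim_prelude ;; move_row) ;;
  ISetVar v_i (IAdd (IVar v_i) (IConst 1)).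

Definition grow_cond : bexpr :=
  BAnd (BNot (BIle (IVar v_r) (IVar v_i)))
    (BNot (BAnd (BIle (IVar v_n) (IVar v_cnt)) (BRle max_depth child_depth))).

Definition grow : cmd := ISetVar v_i (IConst 0) ;; While grow_cond grow_step.

Definition pop_prelude : cmd :=
  ISetVar v_row min_row ;;
  ISetVar v_p (IAdd (IArr a_p (IVar v_row)) (IConst 1)) ;;
  ISetVar v_b (IArr a_b (IVar v_row)) ;;
  ISetArr a_par (IVar v_nodes) (IArr a_p (IVar v_row)) ;;
  ISetArr a_let (IVar v_nodes) (IVar v_row) ;;
  RSetArr a_dep (IVar v_nodes) (RArr a_kmin (IVar v_row)) ;;
  RSetVar x_cost (RSub (RVar x_cost) (RArr a_kmin (IVar v_row))) ;;
  ISetVar v_nodes (IAdd (IVar v_nodes) (IConst 1)) ;;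
  ISetVar v_cnt (ISub (IVar v_cnt) (IConst 1)).

Definition pop_node : cmd := pop_prelude ;; move_row.

(* Moves are logged since the best tree was recorded, so that it can be
   restored at the end. *)
Definition record_best : cmd :=
  If (BAnd (BIle (IVar v_n) (IVar v_cnt))
        (BNot (BAnd (BNot (BIeq (IVar v_best) (IConst 0)))
                 (BRle (RVar x_best) (RVar x_cost)))))
    (ISetVar v_best (IVar v_nodes) ;;
     RSetVar x_best (RVar x_cost) ;;
     ISetVar v_log (IConst 0))
    Skip.

Definition search_cond : bexpr :=
  BNot (BAnd (BIle (IVar v_n) (IVar v_cnt))
    (BRle max_depth (RAdd (RArr a_kmin min_row) (RArr a_c (IConst 1))))).

Definition search : cmd :=
  ISetVar v_nodes (IConst 1) ;; (grow ;; record_best) ;;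
  While search_cond (pop_node ;; grow ;; record_best).

Definition undo_step : cmd :=
  (ISetVar v_log (ISub (IVar v_log) (IConst 1)) ;;
   ISetVar v_row (IArr a_lrow (IVar v_log)) ;;
   ISetVar v_p (IArr a_lp (IVar v_log)) ;;
   ISetVar v_b (IArr a_lb (IVar v_log))) ;;
  set_row.

Definition undo_moves : cmd :=
  While (BNot (BIeq (IVar v_log) (IConst 0))) undo_step.

(** Resetting [v_nodes] forgets the nodes expanded after the best tree was recorded; their cells are
    reused. Extracting the shallowest leaf n times then numbers each leaf and fills in its parent
    and letter, exactly as for internal nodes. *)
Definition emit_leaves : cmd :=
  ISetVar v_nodes (IVar v_best) ;;
  ISetVar v_cnt (IVar v_n) ;;
  While (BNot (BIeq (IVar v_cnt) (IConst 0)))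
    (ISetArr a_term (IVar v_nodes) (IConst 1) ;; pop_node) ;;
  ISetVar v_n (IVar v_nodes).

(** The search makes the root internal at once, which is justified only for n > 1. For n = 1 the
    code is the empty word, and register 0 already holds the number of nodes. *)
Definition code_program : cmd :=
  If (BIle (IVar v_n) (IConst 1))
    (ISetArr a_term (IConst 0) (IConst 1))
    (search ;; undo_moves ;; emit_leaves).

(** * Correctness of the program *)

Fixpoint undo (k : nat) (lrow lp lb p b : nat -> nat) :
    (nat -> nat) * (nat -> nat) :=
  if k is k'.+1 then
    undo k' lrow lp lb (upd p (lrow k') (lp k')) (upd b (lrow k') (lb k'))
  else (p, b).

Lemma undo_ext k lrow lp lb lrow' lp' lb' p b :
  (forall l, (l < k)%N -> [/\ lrow' l = lrow l, lp' l = lp l & lb' l = lb l]) ->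
  undo k lrow' lp' lb' p b = undo k lrow lp lb p b.
Proof.
elim: k p b => //= k IH p b h; have [-> -> ->] := h k (leqnn _).
by apply: IH => l hl; apply: h; lia.
Qed.

(** The pushed entry holds the old counters and is undone first. So a logged move does not change
    [restored], and the record of the best tree survives all later moves. *)
Lemma undo_push k lrow lp lb p b i x y :
  undo k.+1 (upd lrow k i) (upd lp k (p i)) (upd lb k (b i)) (upd p i x)
    (upd b i y) = undo k lrow lp lb p b.
Proof.
rewrite /= !upd_same !upd_upd !upd_id; apply: undo_ext => l hl.
by rewrite !upd_other //; lia.
Qed.

Section Program.
Variables (R : realType) (n r : nat) (c : nat -> R).
Implicit Types s : state R.
Hypothesis n_gt1 : (1 < n)%N.
Hypothesis r_gt1 : (1 < r)%N.
Hypothesis c_ge0 : forall i, (i < r)%N -> 0 <= c i.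
Hypothesis c_mono : forall i j, (i <= j)%N -> (j < r)%N -> c i <= c j.

Local Notation value := (frontier_value c).

Definition input_ok s : Prop :=
  [/\ ivar s v_n = n, ivar s v_r = r & rarr s a_c = c].

Definition restored s : (nat -> nat) * (nat -> nat) :=
  undo (ivar s v_log) (iarr s a_lrow) (iarr s a_lp) (iarr s a_lb)
    (iarr s a_p) (iarr s a_b).

Record best_tree (K N : nat) (dep : nat -> R) (par lett : nat -> nat) (X : R)
    (pb : (nat -> nat) * (nat -> nat)) : Prop := BestTree {
  bt_le : (K <= N)%N;
  bt_nodes : numbered r c K K dep par lett pb.1 pb.2;
  bt_cost : X = gsum r pb.1 pb.2 (value dep);
  bt_count : (\sum_(k < r) pb.2 k = n + \sum_(k < r) pb.1 k)%N
}.

Definition log_ok s : Prop :=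
  (forall k, (k < ivar s v_log)%N -> (iarr s a_lrow k < r)%N) /\
  (ivar s v_best <> 0%N -> best_tree (ivar s v_best) (ivar s v_nodes)
    (rarr s a_dep) (iarr s a_par) (iarr s a_let) (rvar s x_best) (restored s)).

(** Listing the arrays by number makes access to a fixed array reduce by computation; the default of
    [nth] covers all further arrays. *)
Definition moved s (v : nat) (w1 w2 : nat -> nat) (k1 k2 : nat -> R) : state R :=
  let i := ivar s v_row in
  State (upd (upd (ivar s) v_log (ivar s v_log).+1) v_cell v)
    (fun a => nth (iarr s a)
       [:: iarr s a; iarr s a; iarr s a; upd (iarr s a) i (ivar s v_p);
           upd (iarr s a) i (ivar s v_b); w1; w2;
           upd (iarr s a) (ivar s v_log) i;
           upd (iarr s a) (ivar s v_log) (iarr s a_p i);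
           upd (iarr s a) (ivar s v_log) (iarr s a_b i)] a)
    (rvar s)
    (fun a => nth (rarr s a) [:: rarr s a; rarr s a; k1; k2] a).

Definition move_time : nat := 200 * log_time r.

Lemma log_time_gt0 : (0 < log_time r)%N.
Proof. by []. Qed.

Lemma move_rowP s : input_ok s -> (ivar s v_row < r)%N -> ok s -> log_ok s ->
  runs s move_row move_time (fun s' => [/\ ok s', log_ok s' &
    exists v w1 w2 k1 k2, s' = moved s v w1 w2 k1 k2]).
Proof.
move=> [e0 e1 e2] hi hok [hl hb].
apply: (@runs_seq _ _ _ _ 20 (set_row_time r) _ (fun s' => s' = final s push_row)).
- exact: runs_final.
- move=> _ ->; have h := @set_rowP _ (final s push_row).
  have {h} : runs (final s push_row) set_row (set_row_time (ivar s v_r))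
     (fun s' => ok s' /\ exists v w1 w2 k1 k2, s' = with_row (final s push_row)
        (ivar s v_row) (ivar s v_p) (ivar s v_b) v w1 w2 k1 k2).
    by apply: h => //; rewrite /=; rd; rewrite e1.
  rewrite e1; apply: runs_weaken => // s' [hok' [v [w1 [w2 [k1 [k2 e]]]]]].
  have em : with_row (final s push_row) (ivar s v_row) (ivar s v_p)
      (ivar s v_b) v w1 w2 k1 k2 = moved s v w1 w2 k1 k2.
    rewrite /with_row /moved /=; rd; congr State.
    + by rewrite addn1.
    + apply/funext => -[|[|[|[|[|[|[|[|[|[|a]]]]]]]]]] //.
      by rewrite /upd /= nth_nil.
    + by apply/funext => -[|[|[|[|a]]]] //; rewrite /upd /= nth_nil.
  rewrite em in e; subst s'; split => //; last by exists v, w1, w2, k1, k2.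
  split.
    move=> k; rewrite /moved /=; rd => hk; rewrite /upd; case: eqP => // ne.
    by apply: hl; lia.
  move=> /hb g.
  have er : restored (moved s v w1 w2 k1 k2) = restored s.
    by rewrite /restored /moved; exact: undo_push.
  by rewrite er; exact: g.
- by rewrite /move_time /set_row_time; have := log_time_gt0; lia.
Qed.

Definition base s : Prop := [/\ input_ok s, ok s & log_ok s].

Lemma runs_moveP s p : loop_free p -> base (final s p) ->
  (ivar (final s p) v_row < r)%N ->
  runs s (p ;; move_row) (cost_bound p + move_time) (fun s' => base s' /\
    exists v w1 w2 k1 k2, s' = moved (final s p) v w1 w2 k1 k2).
Proof.
move=> lf [b1 b2 b3] hi.
apply: (@runs_seq _ _ _ _ (cost_bound p) move_time _ (fun s' => s' = final s p)) => //.
  exact: runs_final.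
move=> _ ->; apply: runs_weaken (move_rowP b1 hi b2 b3) => // s' [h1 h2 h3].
by split => //; split => //; case: h3 => [v [w1 [w2 [k1 [k2 ->]]]]]; case: b1.
Qed.

Definition selected s (i : nat) : Prop :=
  selection r c (ivar s v_nodes) (ivar s v_cnt) i (rarr s a_dep)
    (iarr s a_par) (iarr s a_let) (iarr s a_p) (iarr s a_b) (rvar s x_cost).

Local Notation min_row_of s := (iarr s a_min 1 - 1)%N.
Local Notation max_row_of s := (iarr s a_max 1 - 1)%N.

Lemma min_rowP s : base s -> (exists2 k, (k < r)%N & (iarr s a_p k < iarr s a_b k)%N) ->
  let i := min_row_of s in
  [/\ (i < r)%N, (iarr s a_p i < iarr s a_b i)%N &
      rarr s a_kmin i = value (rarr s a_dep) (iarr s a_p i) i].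
Proof.
move=> [[_ e1 e2] [t1 _ hk] _] [k hk' lt] /=; rewrite e1 in t1 hk.
have [_ a1 a2 _] := tournament_root t1 hk' lt.
by have [-> _] := hk _ a1 a2; rewrite e2.
Qed.

Lemma topsP s i : base s -> selected s i -> (0 < ivar s v_cnt)%N ->
  let dep := rarr s a_dep in
  let p := iarr s a_p in
  let b := iarr s a_b in
  let i0 := min_row_of s in
  let i1 := max_row_of s in
  [/\ (i0 < r)%N, (p i0 < b i0)%N,
      rarr s a_kmin i0 = value dep (p i0) i0 &
      all_leaves r c dep p b (fun x => value dep (p i0) i0 <= x)] /\
  [/\ (i1 < r)%N, (p i1 < b i1)%N,
      rarr s a_kmax i1 = 0 - value dep (b i1 - 1) i1 &
      all_leaves r c dep p b (fun x => x <= value dep (b i1 - 1) i1)].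
Proof.
move=> [[_ e1 e2] [t1 t2 hk] _] sel cnt0 /=; rewrite e1 in t1 t2 hk.
set p := iarr s a_p in t1 t2 hk *; set b := iarr s a_b in t1 t2 hk *.
have [k hk' lt] : exists2 k, (k < r)%N & (p k < b k)%N.
  have [[k lt]|no] := EM (exists k : 'I_r, (p k < b k)%N); first by exists k.
  have := sl_b sel; have : (\sum_(k < r) b k <= \sum_(k < r) p k)%N.
    by apply: leq_sum => k _; rewrite leqNgt; apply/negP => lt; apply: no; exists k.
  by move: cnt0; rewrite -/p -/b; lia.
have bN l : (l < r)%N -> (b l <= ivar s v_nodes)%N.
  by move=> hl; have := nb_rows (sl_nodes sel) l; rewrite hl => /andP[].
have key l : (l < r)%N -> (p l < b l)%N ->
    rarr s a_kmin l = value (rarr s a_dep) (p l) l /\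
    rarr s a_kmax l = 0 - value (rarr s a_dep) (b l - 1) l.
  by move=> hl ll; have := hk l hl ll; rewrite e2.
have [_ a1 a2 _] := tournament_root t1 hk' lt.
have [_ b1 b2 _] := tournament_root t2 hk' lt.
split; split => //.
- by have [] := key _ a1 a2.
- move=> l j hl hj; have al : (p l < b l)%N by lia.
  have [_ _ _] := tournament_root t1 hl al.
  have [-> _] := key _ a1 a2; have [-> _] := key _ hl al.
  move/le_trans; apply; rewrite lerD2r; apply: (sl_mono sel).
  by have := bN l hl; lia.
- by have [] := key _ b1 b2.
- move=> l j hl hj; have al : (p l < b l)%N by lia.
  have [_ _ _] := tournament_root t2 hl al.
  have [_ ->] := key _ b1 b2; have [_ ->] := key _ hl al.
  rewrite lerD2l lerN2; apply: le_trans; rewrite lerD2r.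
  by apply: (sl_mono sel); have := bN l hl; lia.
Qed.

(** By [add_count], k children of node number N (counted from 1) require k N <= n + N. *)
Definition max_children (N : nat) : nat := minn r (n %/ N).+1.

Definition unchanged s0 s : Prop :=
  [/\ ivar s v_nodes = ivar s0 v_nodes, ivar s v_best = ivar s0 v_best,
      rvar s x_best = rvar s0 x_best, iarr s a_p = iarr s0 a_p &
      rarr s a_dep = rarr s0 a_dep] /\
  iarr s a_term = iarr s0 a_term.

Record growing s0 (i : nat) s : Prop := Growing {
  gr_base : base s;
  gr_unchanged : unchanged s0 s;
  gr_selected : selected s i;
  gr_filled : filled r c n (ivar s v_nodes) (ivar s v_cnt) i (rarr s a_dep)
    (iarr s a_b);
  gr_two : two_children r c n (ivar s v_nodes) (ivar s v_cnt) i (rarr s a_dep)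
    (iarr s a_p) (iarr s a_b);
  gr_cnt : (ivar s v_cnt <= n)%N;
  gr_children : (i <= max_children (ivar s v_nodes))%N;
  gr_log : (ivar s v_log <= ivar s0 v_log + 2 * i)%N
}.

Lemma grow_condP s0 i s : growing s0 i s -> ivar s v_i = i ->
  beval s grow_cond = (i < r)%N && ~~ ((n <= ivar s v_cnt)%N &&
    (value (rarr s a_dep) (iarr s a_b (max_row_of s) - 1) (max_row_of s) <=
     rarr s a_dep (ivar s v_nodes).-1 + c i)).
Proof.
move=> g ei; have [[e0 e1 e2] _ _] := gr_base g.
rewrite /= e0 e1 e2 ei -ltnNge [(ivar s 2 - 1)%N]subn1; case: (leqP n (ivar s v_cnt)) => // le.
have [|_ [_ _ -> _]] := topsP (gr_base g) (gr_selected g); first by lia.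
by rewrite mulr0n !sub0r opprK.
Qed.

Lemma growing_can_add s0 i s : growing s0 i s -> ivar s v_i = i ->
  beval s grow_cond -> (i < r)%N /\
  can_add r c n (ivar s v_nodes) (ivar s v_cnt) i (rarr s a_dep)
    (iarr s a_p) (iarr s a_b).
Proof.
move=> g ei; rewrite (grow_condP g ei) => /andP[hi].
rewrite negb_and -ltnNge -ltNge => /orP[lt|lt]; split => //; first by left.
case: (leqP n (ivar s v_cnt)) => le; [right|by left].
have [|_ [h1 h2 _ _]] := topsP (gr_base g) (gr_selected g); first by lia.
exists (max_row_of s), (iarr s a_b (max_row_of s) - 1)%N.
by split => //; lia.
Qed.

Definition step_time : nat := 500 * log_time r.

Lemma grow_stepP s0 i s : growing s0 i s -> ivar s v_i = i ->
  beval s grow_cond ->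
  runs s grow_step step_time (fun s' => growing s0 i.+1 s' /\ ivar s' v_i = i.+1).
Proof.
move=> g ei hc; have [hi ca] := growing_can_add g ei hc.
have [[be0 be1 be2] bok blog] := gr_base g.
have cntn := gr_cnt g; have sel := gr_selected g.
have deep := rest_deep sel hi cntn (gr_filled g) ca.
have bi := add_b c_mono sel hi deep; have N0 := N_gt0 sel.
pose bs := upd (iarr s a_b) i (iarr s a_b i).+1.
have count : (i.+1 <= max_children (ivar s v_nodes))%N.
  rewrite /max_children leq_min hi ltnS leq_divRL //.
  by have := add_count c_mono sel hi deep; lia.
pose Q1 s' := [/\ base s', unchanged s0 s', selected s' i.+1,
  iarr s' a_b = bs & ivar s' v_cnt = (ivar s v_cnt).+1] /\
  (ivar s' v_log = (ivar s v_log).+1 /\ ivar s' v_i = i).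
apply: (@runs_seq _ _ _ _ (30 + move_time) (40 + move_time) _ Q1); last first.
- by rewrite /step_time /move_time; have := log_time_gt0; lia.
- move=> s1 [[b1 u1 sel1 eb ecnt] [elog ei1]].
  have [[b1e0 b1e1 b1e2] ok1 log1] := b1.
  have [[uN ub ux up ud] ut] := u1.
  have [[vN vb vx vp vd] vt] := gr_unchanged g.
  have tw1 : (ivar s v_cnt < n)%N -> two_children r c n (ivar s1 v_nodes)
      (ivar s1 v_cnt) i.+1 (rarr s1 a_dep) (iarr s1 a_p) (iarr s1 a_b).
    by move=> lt; rewrite uN -vN ecnt up -vp ud -vd eb; apply: two_children_add => //; exact: gr_two g.
  pose Q2 s' := growing s0 i.+1 s' /\ ivar s' v_i = i.
  apply: (@runs_seq _ _ _ _ (36 + move_time) 4 _ Q2); last first.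
  + by lia.
  + move=> s2 [g2 ei2]; apply: runs_final => //=; split; last by rewrite /= ei2 addn1.
    by case: g2 => *; refine (@Growing s0 i.+1 _ _ _ _ _ _ _ _ _).
  apply: (@runs_if _ _ _ _ _ (30 + move_time)) => /=; last by lia.
    rewrite b1e0 ecnt => le; apply: runs_final => //.
    split => //; split => //=.
    + rewrite uN -vN ecnt ud -vd eb; apply: filled_add => //; exact: gr_filled g.
    + exact: tw1.
    + by rewrite ecnt.
    + by rewrite uN -vN.
    + by have := gr_log g; lia.
  rewrite b1e0 ecnt -ltnNge => ltn; have en : ivar s v_cnt = n by lia.
  have [|_ [h1 h2 h3 h4]] := topsP b1 sel1; first by lia.
  have : runs s1 (trim_prelude ;; move_row) (cost_bound trim_prelude + move_time)
     (fun s' => base s' /\ exists v w1 w2 k1 k2,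
         s' = moved (final s1 trim_prelude) v w1 w2 k1 k2).
    by apply: runs_moveP => //; exact: b1.
  apply: runs_weaken; first by rewrite leq_add2r.
move=> s' [bs' [v [w1 [w2 [k1 [k2 es']]]]]].
  have sel' : selected s' i.+1.
    rewrite es' /selected /=; rd; rewrite h3 upd_id sub0r ecnt subn1 /=.
    apply: selection_remove => //; by rewrite -ecnt; exact: sel1.
  split; last by rewrite es' /=; rd.
  have ecnt' : ivar s' v_cnt = n by rewrite es' /=; rd; rewrite ecnt subn1 /= en.
  split => //.
  + by rewrite es' /unchanged /=; rd; rewrite upd_id.
  + by left; left.
  (* Trimming means that n leaves were already present, whereas [two_children] leaves room for the
     child by letter 0; so only i + 1 >= 2 occurs and the claim is vacuous. *)
  + move=> i2; have [] := gr_two g; first lia.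
    by rewrite en; move: i2; lia.
  + by rewrite ecnt'.
  + by rewrite es' /=; rd; rewrite uN -vN.
  + by rewrite es' /=; rd; rewrite elog; have := gr_log g; lia.
have : runs s (add_child_prelude ;; move_row) (cost_bound add_child_prelude + move_time)
   (fun s' => base s' /\ exists v w1 w2 k1 k2,
       s' = moved (final s add_child_prelude) v w1 w2 k1 k2).
  by apply: runs_moveP => //; rewrite /=; rd; rewrite ei.
apply: runs_weaken; first by rewrite leq_add2r.
move=> s' [bs' [v [w1 [w2 [k1 [k2 es']]]]]].
split; last by rewrite es' /=; rd.
split => //.
- by rewrite es' /unchanged /=; rd; rewrite ei upd_id; exact: gr_unchanged g.
- rewrite es' /selected /=; rd; rewrite ei upd_id !addn1 subn1 be2 -bi.
  exact: (selection_add c_mono sel hi deep).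
- by rewrite es' /=; rd; rewrite ei addn1.
- by rewrite es' /=; rd; rewrite addn1.
Qed.

Record grown s0 s : Prop := Grown {
  gn_base : base s;
  gn_unchanged : unchanged s0 s;
  gn_selected : selected s r;
  gn_filled : filled r c n (ivar s v_nodes) (ivar s v_cnt) r (rarr s a_dep)
    (iarr s a_b);
  gn_cnt : (ivar s v_cnt <= n)%N;
  gn_nodes : (ivar s v_nodes <= n)%N;
  gn_log : (ivar s v_log <=
            ivar s0 v_log + 2 * max_children (ivar s0 v_nodes))%N
}.

Definition ready s : Prop :=
  [/\ base s, selected s 0,
      filled r c n (ivar s v_nodes) (ivar s v_cnt) 0 (rarr s a_dep) (iarr s a_b),
      two_children r c n (ivar s v_nodes) (ivar s v_cnt) 0 (rarr s a_dep)
        (iarr s a_p) (iarr s a_b) &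
      (ivar s v_cnt <= n)%N].

Definition grow_time (N : nat) : nat :=
  600 * log_time r * (max_children N).+1.

Lemma growP s : ready s ->
  runs s grow (grow_time (ivar s v_nodes)) (grown s).
Proof.
move=> [b0 sel0 fil0 two0 cnt0].
have L0 := log_time_gt0.
pose Q s' := growing s (ivar s' v_i) s'.
pose f s' := ((max_children (ivar s' v_nodes) - ivar s' v_i) * (step_time + 30))%N.
apply: (@runs_seq _ _ _ _ 2 (max_children (ivar s v_nodes) * (step_time + 30) + 30)
  _ (fun s' => s' = final s (ISetVar v_i (IConst 0)))); first exact: runs_final.
- move=> _ ->; set s1 := final _ _.
  have q1 : Q s1 by split => //; rewrite leq_addr.
  apply: (@runs_weaken _ _ _ (max_children (ivar s v_nodes) * (step_time + 30) + 30) _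
    (fun s' => Q s' /\ ~~ beval s' grow_cond)) => //; last first.
    apply: (runs_while (f := f) _ q1).
      move=> s2 q2 hc; exists step_time.
      apply: runs_weaken (grow_stepP q2 erefl hc) => // s3 [g3 e3].
      split; first by rewrite /Q e3.
      rewrite /f e3; have := gr_children g3.
      have [[-> _ _ _ _] _] := gr_unchanged g3; have [[-> _ _ _ _] _] := gr_unchanged q2.
      set u := max_children _; set i := ivar s2 _ => lt.
      have -> : (u - i)%N = (u - i.+1).+1 by lia.
      by rewrite mulSn /=; lia.
    by rewrite /f /= ; rd; rewrite subn0; lia.
  move=> s2 [g]; rewrite (grow_condP g erefl) => hc.
  have [[bi0 bi1 bi2] _ _] := gr_base g.
  set i := ivar s2 v_i in g hc.
  have ir : (i <= r)%N by apply: leq_trans (gr_children g) _; rewrite geq_minl.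
  have stop : (i < r)%N -> (ivar s2 v_cnt = n) /\ all_leaves r c (rarr s2 a_dep)
      (iarr s2 a_p) (iarr s2 a_b) (fun x => x <= rarr s2 a_dep (ivar s2 v_nodes).-1 + c i).
    move=> lt; move: hc; rewrite lt /= negbK => /andP[le1 le2].
    have [|_ [_ _ _ h]] := topsP (gr_base g) (gr_selected g); first by lia.
    split; first by have := gr_cnt g; lia.
    by move=> k j hk hj; apply: le_trans le2; exact: h.
  (* Growth cannot stop before two children have been generated: at i < 2 [two_children] provides a
     free place or a strictly deeper leaf, against the exit condition. *)
  have i2 : (1 < i)%N.
    rewrite ltnNge; apply/negP => lt.
    have [|ecnt h] := stop; first lia.
    have := two_children_can_add _ (gr_two g); rewrite /can_add ecnt ltnn.
    move=> /(_ lt)[//|[k [j [hk hj]]]]; rewrite ltNge => /negP; apply.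
    exact: h.
  have N0 := N_gt0 (gr_selected g).
  split.
  + exact: gr_base g.
  + exact: gr_unchanged g.
  + apply: (selection_exit c_mono ir _ (gr_selected g)) => lt.
    by have [] := stop lt.
  + case: (gr_filled g) => [[e|e]|[e]]; [by left; left| |by lia].
    have [lt|ge] := ltnP i r; first by left; left; have [] := stop lt.
    by left; right => k hk; rewrite e // /row_end hk (leq_trans hk ge).
  + exact: gr_cnt g.
  (* With i >= 2 and i <= n %/ N + 1 the quotient is positive, that is, N <= n. *)
  + have := gr_children g; rewrite /max_children leq_min => /andP[_ le].
    have : (1 <= n %/ ivar s2 v_nodes)%N by lia.
    by rewrite divn_gt0.
  + apply: leq_trans (gr_log g) _; rewrite leq_add2l leq_mul2l /=.
    by have [[<- _ _ _ _] _] := gr_unchanged g; exact: gr_children g.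
- rewrite /grow_time /step_time.
  move: (max_children _) => u; nia.
Qed.

(** The new depth is written in cell [v_nodes], while the rows and the recorded tree refer to
    smaller node numbers only; so keys, tournaments and the recorded cost stay valid. *)
Lemma runs_popP s : base s ->
  (forall k, (iarr s a_b k <= ivar s v_nodes)%N) ->
  (exists2 k, (k < r)%N & (iarr s a_p k < iarr s a_b k)%N) ->
  runs s pop_node (60 + move_time) (fun s' => base s' /\
    exists v w1 w2 k1 k2, s' = moved (final s pop_prelude) v w1 w2 k1 k2).
Proof.
move=> bs bN act; have [i_lt i_act key] := min_rowP bs act.
case: bs => [[e0 e1 e2] [t1 t2 hk] [l1 l2]].
apply: (@runs_weaken _ _ _ (cost_bound pop_prelude + move_time) _ _ _ _ (fun s' H => H)).
  by rewrite leq_add2r.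
apply: runs_moveP => //.
have dN j : (j < ivar s v_nodes)%N -> rarr (final s pop_prelude) a_dep j = rarr s a_dep j.
  by move=> lt; rewrite /=; rd; rewrite upd_other //; lia.
split => //.
  split => // k hk' ak; have [h1 h2] := hk k hk' ak.
  have bk := bN k; have {}ak : (iarr s a_p k < iarr s a_b k)%N by exact: ak.
  have -> : rarr (final s pop_prelude) a_dep (iarr (final s pop_prelude) a_p k) =
      rarr s a_dep (iarr s a_p k) by apply: dN;
    change (iarr s a_p k < ivar s v_nodes)%N; lia.
  have -> : rarr (final s pop_prelude) a_dep (iarr (final s pop_prelude) a_b k - 1)%N =
      rarr s a_dep (iarr s a_b k - 1)%N by apply: dN;
    change (iarr s a_b k - 1 < ivar s v_nodes)%N; lia.
  by split.
split; first exact: l1.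
move=> /l2[g1 g2 g3 g4]; split.
- by rewrite /=; rd; move: g1; rewrite /=; lia.
- apply: numbered_ext g2 => v hv; rewrite /=; rd.
  by rewrite !upd_other //; move: hv; rewrite /=; rd; lia.
- rewrite [LHS]g3; apply: eq_gsum => k j hk' hj; rewrite /frontier_value dN //.
  by have := nb_rows g2 k; rewrite hk'; move: hj g1; rewrite /=; lia.
- exact: g4.
Qed.

Definition settled s (t0 : ctree) : Prop :=
  ivar s v_best <> 0%N /\ rvar s x_best <= cost r c t0.

(** One move for the expansion of a node, and for each child one for its addition and one for a
    possible trimming. *)
Definition log_bound (N : nat) : nat := \sum_(1 <= m < N.+1) (2 * max_children m + 1).

Record searching s : Prop := Searching {
  sr_base : base s;
  sr_selected : selected s r;
  sr_filled : filled r c n (ivar s v_nodes) (ivar s v_cnt) r (rarr s a_dep)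
    (iarr s a_b);
  sr_cnt : (ivar s v_cnt <= n)%N;
  sr_nodes : (ivar s v_nodes <= n)%N;
  sr_undecided : undecided r c n (settled s) (ivar s v_nodes) (rarr s a_dep)
    (iarr s a_p);
  sr_best : ivar s v_cnt = n ->
    ivar s v_best <> 0%N /\ rvar s x_best <= rvar s x_cost;
  sr_log : (ivar s v_log <= log_bound (ivar s v_nodes))%N;
  sr_term : iarr s a_term = fun=> 0%N
}.

Lemma grow_recordP s : ready s -> iarr s a_term = (fun=> 0%N) ->
  undecided r c n (settled s) (ivar s v_nodes) (rarr s a_dep) (iarr s a_p) ->
  (ivar s v_log < log_bound (ivar s v_nodes).-1 + 2)%N ->
  runs s (grow ;; record_best) (grow_time (ivar s v_nodes) + 40)
    (fun s' => searching s' /\ ivar s' v_nodes = ivar s v_nodes).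
Proof.
move=> rs term und lg; have N0 : (0 < ivar s v_nodes)%N by case: rs => _ /N_gt0.
apply: (runs_seq (growP rs)); last exact: leqnn.
move=> s1 g; have [[uN ub ux up ud] ut] := gn_unchanged g.
have [[e0 e1 e2] okb [lr lb]] := gn_base g.
have sel1 := gn_selected g.
have lg1 : (ivar s1 v_log <= log_bound (ivar s1 v_nodes))%N.
  apply: leq_trans (gn_log g) _; rewrite uN.
  rewrite -[in leqRHS](prednK N0) /log_bound big_nat_recr //= prednK //.
  by move: lg; rewrite /log_bound prednK //; lia.
have set1 t0 : settled s t0 -> settled s1 t0 by rewrite /settled ub ux.
have und1 : undecided r c n (settled s1) (ivar s1 v_nodes) (rarr s1 a_dep) (iarr s1 a_p).
  by rewrite uN ud up => t0 /und[/set1|]; [left|right].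
apply: (@runs_if _ _ _ _ _ 20) => //.
  rewrite /= e0 => /andP[cn better].
  have cnt : ivar s1 v_cnt = n by have := gn_cnt g; lia.
  apply: runs_final => //; set s2 := final _ _.
  have le : ivar s1 v_best <> 0%N -> rvar s1 x_cost <= rvar s1 x_best.
    move=> /eqP nz; move: better; rewrite nz /= -ltNge; exact: ltW.
  split => //; split => //.
  - split => //; split => // _; split => //.
    + exact: sl_nodes sel1.
    + exact: sl_cost sel1.
    + by have := sl_b sel1; rewrite cnt.
  - exact: gn_filled g.
  - exact: gn_cnt g.
  - exact: gn_nodes g.
  - move=> t0 /und1[[nz le']|]; [left; split|by right].
      by rewrite /=; rd; move=> e; move: N0; rewrite -uN e.
    by apply: le_trans le'; exact: le.
  - by move=> _; split => //=; rd; move=> e; move: N0; rewrite -uN e.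
  - by rewrite [LHS]ut.
rewrite /= e0 negb_and negbK -ltnNge => hn; apply: runs_final => //=.
split => //; split => //.
- exact: gn_filled g.
- exact: gn_cnt g.
- exact: gn_nodes g.
- move=> cnt; move: hn; rewrite cnt ltnn /= => /andP[/eqP h1 h2]; split => //.
- by rewrite ut.
Qed.

Lemma search_condP s : searching s -> beval s search_cond =
  ~~ ((n <= ivar s v_cnt)%N &&
      (value (rarr s a_dep) (iarr s a_b (max_row_of s) - 1) (max_row_of s) <=
       value (rarr s a_dep) (iarr s a_p (min_row_of s)) (min_row_of s) + c 1)).
Proof.
move=> g; have [[e0 e1 e2] _ _] := sr_base g.
rewrite /= e0 e2; case: (leqP n (ivar s v_cnt)) => //= le.
have [|[_ _ -> _] [_ _ -> _]] := topsP (sr_base g) (sr_selected g); first lia.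
by rewrite mulr0n !sub0r opprK.
Qed.

Lemma sum_leaf s : (\sum_(k < r) iarr s a_p k < \sum_(k < r) iarr s a_b k)%N ->
  exists2 k, (k < r)%N & (iarr s a_p k < iarr s a_b k)%N.
Proof.
move=> lt; have [[k h]|no] := EM (exists k : 'I_r, (iarr s a_p k < iarr s a_b k)%N).
  by exists k.
move: lt; rewrite ltnNge => /negP[]; apply: leq_sum => k _.
by rewrite leqNgt; apply/negP => h; apply: no; exists k.
Qed.

Lemma search_popP s : searching s -> beval s search_cond ->
  runs s pop_node (60 + move_time) (fun s' => [/\ ready s',
    iarr s' a_term = fun=> 0%N,
    undecided r c n (settled s') (ivar s' v_nodes) (rarr s' a_dep) (iarr s' a_p),
    ivar s' v_nodes = (ivar s v_nodes).+1 &
    (ivar s' v_log < log_bound (ivar s v_nodes) + 2)%N]).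
Proof.
move=> g; rewrite (search_condP g) => hc.
have sel := sr_selected g; have bs := sr_base g.
have fil := sr_filled g; have cntn := sr_cnt g.
(* If the whole frontier is in the tree, it has r N - (N - 1) > 0 leaves. *)
have cnt0 : (0 < ivar s v_cnt)%N.
  case: (filled_frontier (ltnW r_gt1) fil) => [->|e]; first lia.
  have : (\sum_(k < r) iarr s a_p k < \sum_(k < r) iarr s a_b k)%N.
    have -> : (\sum_(k < r) iarr s a_b k = r * ivar s v_nodes)%N.
      rewrite (eq_bigr (fun=> ivar s v_nodes)) => [|k _]; last by rewrite e.
      by rewrite sum_nat_const card_ord.
    by have := sl_p sel; nia.
  by have := sl_b sel; lia.
have [[a1 a2 a3 a4] [b1 b2 b3 b4]] := topsP bs sel cnt0.
set i0 := min_row_of s in hc a1 a2 a3 a4; set i1 := max_row_of s in hc b1 b2 b3 b4.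
have go : (ivar s v_cnt < n)%N \/ some_leaf r c (rarr s a_dep) (iarr s a_p)
    (iarr s a_b) (fun x => value (rarr s a_dep) (iarr s a_p i0) i0 + c 1 < x).
  move: hc; rewrite negb_and -ltnNge -ltNge => /orP[lt|lt]; [by left|right].
  by exists i1, (iarr s a_b i1 - 1)%N; split => //; lia.
have [[e0 e1 e2] _ _] := bs.
have : runs s pop_node (60 + move_time) (fun s' => base s' /\
    exists v w1 w2 k1 k2, s' = moved (final s pop_prelude) v w1 w2 k1 k2).
  apply: runs_popP => //.
    by move=> k; have := nb_rows (sl_nodes sel) k; case: ifP; lia.
  by exists i0.
apply: runs_weaken => // s' [bs' [v [w1 [w2 [k1 [k2 es]]]]]].
have ecnt : ivar s v_cnt = (ivar s v_cnt - 1).+1 by lia.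
have eN : ivar s' v_nodes = (ivar s v_nodes).+1 by rewrite es /=; rd; rewrite addn1.
have ed : rarr s' a_dep = upd (rarr s a_dep) (ivar s v_nodes)
    (value (rarr s a_dep) (iarr s a_p i0) i0) by rewrite es /=; rd; rewrite a3.
have ep : iarr s' a_p = upd (iarr s a_p) i0 (iarr s a_p i0).+1.
  by rewrite es /=; rd; rewrite addn1.
have eb : iarr s' a_b = iarr s a_b by rewrite es /=; rd; rewrite upd_id.
have ec : ivar s' v_cnt = (ivar s v_cnt - 1)%N by rewrite es.
split => //.
- split => //.
  + rewrite /selected eN ed ep eb ec.
    have -> : rvar s' x_cost = rvar s x_cost - value (rarr s a_dep) (iarr s a_p i0) i0.
      by rewrite es /=; rd; rewrite a3.
    have := selection_pop c_ge0 r_gt1 sel a1 a2 a4 ecnt.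
    by rewrite es.
  + rewrite eN ed eb ec; exact: (filled_pop c_mono r_gt1 sel a1 a2 fil cntn go ecnt).
  + rewrite eN ed ep eb ec.
    exact: (two_children_pop c_ge0 r_gt1 sel a1 a2 cntn go ecnt).
  + by rewrite ec; lia.
- by rewrite es; exact: sr_term g.
- rewrite eN ed ep.
  have : undecided r c n (settled s) (ivar s v_nodes).+1
    (upd (rarr s a_dep) (ivar s v_nodes) (value (rarr s a_dep) (iarr s a_p i0) i0))
    (upd (iarr s a_p) i0 (iarr s a_p i0).+1).
    apply: (undecided_pop c_ge0 r_gt1 sel a1 a2 a4 fil cntn b1 b2 b4 _ (sr_undecided g)).
    by move=> cn t0 le; have [h1 h2] := sr_best g cn; split => //; apply: le_trans le.
  by rewrite es.
- by rewrite es /=; rd; have := sr_log g; lia.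
Qed.

Definition work : nat := \sum_(1 <= m < n.+1) (max_children m).+1.

Definition search_time : nat := 1000 * log_time r * work + 40.

Record initial s : Prop := Initial {
  in_input : input_ok s;
  in_ivar : forall x, (1 < x)%N -> ivar s x = 0%N;
  in_iarr : forall a, iarr s a = fun=> 0%N;
  in_rvar : forall x, rvar s x = 0;
  in_rarr : forall a, (0 < a)%N -> rarr s a = fun=> 0
}.

(** A tree with n > 1 leaves is a [Node], so its branches are distributed over the children of the
    root. The root counts as internal from the start, with none of its children generated. *)
Lemma ready_initial s : initial s ->
  let s1 := final s (ISetVar v_nodes (IConst 1)) in
  ready s1 /\
  undecided r c n (settled s1) 1 (rarr s1 a_dep) (iarr s1 a_p).
Proof.
move=> [[e0 e1 e2] iv ia rv ra] /=; split.
- split.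
  + split => //.
      split; try by move=> u hu; split=> [k hk _|]; rewrite /active /= !ia.
      by move=> k hk; rewrite /active /= !ia.
    split; first by move=> k; rewrite /= /upd /= iv.
    by rewrite /= /upd /= iv.
  + rewrite /selected /=; rd; rewrite !ia ra // !iv //.
    have s0 : (\sum_(k < r) 0 = 0)%N by rewrite big1.
    split.
    * by split => // [v|v v']; lia.
    * by move=> *; exact: lexx.
    * by rewrite s0.
    * by rewrite s0.
    * by rewrite rv /gsum big1 // => k _; rewrite big_geq.
    * by move=> k hk _; rewrite /frontier_value add0r c_ge0.
    * by [].
    * by move=> k j k' j' _; rewrite ltn0 andbF.
  + left; right => k hk; rewrite /= ia; rd.
    by rewrite /row_end ltn0.
  + by move=> _; rewrite /=; rd; rewrite iv //; split; [lia|left; lia].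
  + by rewrite /=; rd; rewrite iv.
rewrite !ia ra // => t0; case: t0 => [| |f] /= ht0; [lia|lia|right].
exists (fun _ i => f i); split.
  rewrite -ht0 natr_sum; apply: eq_bigr => k _.
  by rewrite big_nat1.
apply: ler_sum => k _; rewrite big_nat1 /cost_at /frontier_value add0r.
by rewrite lexx.
Qed.

Record searched s : Prop := Searched {
  sd_base : base s;
  sd_best : ivar s v_best <> 0%N;
  sd_le : (ivar s v_best <= n)%N;
  sd_optimal : forall t0, leaves r t0 = n -> rvar s x_best <= cost r c t0;
  sd_log : (ivar s v_log <= log_bound n)%N;
  sd_term : iarr s a_term = fun=> 0%N
}.

Lemma searchP s : initial s -> runs s search search_time searched.
Proof.
move=> ini; have [rdy und] := ready_initial ini.
pose W m := (1000 * log_time r * (max_children m).+1)%N.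
have L0 := log_time_gt0.
have WE : (\sum_(1 <= m < n.+1) W m = 1000 * log_time r * work)%N.
  by rewrite /work big_distrr.
have W1 : (\sum_(1 <= m < n.+1) W m = W 1 + \sum_(2 <= m < n.+1) W m)%N.
  by rewrite big_ltn //; lia.
apply: (@runs_seq _ _ _ _ 2 (1000 * log_time r * work + 38) _
  (fun s' => s' = final s (ISetVar v_nodes (IConst 1)))).
- exact: runs_final.
- move=> _ ->; set s1 := final _ _ in rdy und *.
  apply: (@runs_seq _ _ _ _ (grow_time 1 + 40)
     (\sum_(2 <= m < n.+1) W m + 30) _
     (fun s' => searching s' /\ ivar s' v_nodes = 1%N)).
  + apply: grow_recordP => //.
      exact: in_iarr ini _.
    by rewrite /=; rd; rewrite (in_ivar ini) // addn2.
  + move=> s2 [g2 e2].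
    (* The potential sums the time of the rounds for node numbers not yet reached; [sr_nodes] bounds
       these numbers by n. *)
    pose f s' := (\sum_((ivar s' v_nodes).+1 <= m < n.+1) W m)%N.
    have : runs s2 (While search_cond (pop_node;; grow;; record_best))
       (f s2 + 30) (fun s' => searching s' /\ ~~ beval s' search_cond).
      apply: (runs_while (f := f)) => //; last by rewrite leq_add2l.
      move=> s3 g3 hc.
      exists (60 + move_time + (grow_time (ivar s3 v_nodes).+1 + 40))%N.
      apply: (runs_seq (search_popP g3 hc)); last exact: leqnn.
      move=> s4 [r4 t4 u4 n4 l4]; rewrite -n4.
      apply: runs_weaken (grow_recordP r4 t4 u4 _) => //; last by rewrite n4.
      move=> s5 [g5 e5]; split => //.
      rewrite /f e5 n4 [leqRHS]big_ltn; last by have := sr_nodes g5; lia.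
      rewrite leq_add2r /W /grow_time /move_time.
      by move: (max_children _) => u; cbn [bcost icost rcost search_cond max_depth min_row max_row]; nia.
    rewrite /f e2; apply: runs_weaken => // s3 [g3]; rewrite (search_condP g3) negbK.
    move=> /andP[cn stop]; have cnt : ivar s3 v_cnt = n by have := sr_cnt g3; lia.
    have [nz le] := sr_best g3 cnt.
    have [|[a1 a2 a3 a4] [b1 b2 b3 b4]] := topsP (sr_base g3) (sr_selected g3).
      by lia.
    have opt : forall t0, leaves r t0 = n -> settled s3 t0.
      apply: (undecided_stop c_ge0 c_mono r_gt1 (sr_selected g3) a1 a2 a4
        (sr_cnt g3) b1 b2 b4 _ cnt stop (sr_undecided g3)).
      by move=> _ t0 le'; split => //; apply: le_trans le'.
    have [_ _ [_ lb]] := sr_base g3.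
    split => //.
    * exact: sr_base g3.
    * by apply: leq_trans (bt_le (lb nz)) (sr_nodes g3).
    * by move=> t0 /opt[].
    * apply: leq_trans (sr_log g3) _; rewrite /log_bound.
      have h := sr_nodes g3.
      by rewrite [leqRHS](@big_cat_nat _ _ _ (ivar s3 v_nodes).+1) //= leq_addr.
    * exact: sr_term g3.
  + by rewrite -WE W1 /W /grow_time; lia.
- by rewrite /search_time; lia.
Qed.

Definition undo_time : nat := log_bound n * (220 * log_time r) + 5.

Definition kept s0 s : Prop :=
  [/\ ivar s v_best = ivar s0 v_best, rvar s x_best = rvar s0 x_best,
      iarr s a_term = iarr s0 a_term & restored s = restored s0].

Lemma undoP s : searched s ->
  runs s undo_moves undo_time
    (fun s' => [/\ base s', ivar s' v_log = 0%N & kept s s']).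
Proof.
move=> sd; have L0 := log_time_gt0.
pose I s' := base s' /\ kept s s'.
pose f s' := (ivar s' v_log * (220 * log_time r))%N.
apply: (@runs_weaken _ _ _ undo_time _ (fun s' => I s' /\
   ~~ beval s' (BNot (BIeq (IVar v_log) (IConst 0))))) => //.
  by move=> s' [[h1 h2]] /=; rewrite negbK => /eqP.
apply: (runs_while (f := f)); last first.
- by rewrite /f /undo_time leq_add // leq_mul2r (sd_log sd) orbT.
- by split => //; exact: sd_base sd.
move=> s1 [[[e0 e1 e2] ok1 [l1 b1]] [k1 k2 k3 k4]] /= hl.
have {}hl : (0 < ivar s1 v_log)%N by lia.
exists (210 * log_time r)%N.
rewrite /undo_step; set pre := (ISetVar v_log _ ;; _).
apply: (@runs_seq _ _ _ _ 25 (set_row_time r) _ (fun s' => s' = final s1 pre)).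
- exact: runs_final.
- move=> _ ->.
  have lt : (iarr s1 a_lrow (ivar s1 v_log - 1) < r)%N by apply: l1; lia.
  have : runs (final s1 pre) set_row (set_row_time (ivar (final s1 pre) v_r))
      (fun s' => ok s' /\ exists v w1 w2 k1 k2, s' = with_row (final s1 pre)
        (ivar (final s1 pre) v_row) (ivar (final s1 pre) v_p)
        (ivar (final s1 pre) v_b) v w1 w2 k1 k2).
    by apply: set_rowP => //; rewrite /=; rd; rewrite e1.
  have -> : ivar (final s1 pre) v_r = r by [].
  apply: runs_weaken => // s' [ok' [v [w1 [w2 [q1 [q2 es]]]]]].
  have er : restored s' = restored s1.
    rewrite es /restored /=; rd.
    by case: (ivar s1 v_log) hl => // m _; rewrite subn1.
  split; last by rewrite es /f /=; rd; nia.
  split; last by split; [rewrite es|rewrite es|rewrite es|rewrite er].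
  split => //; first by rewrite es.
  split; first by move=> k; rewrite es /=; rd => hk; apply: l1; lia.
  by move: b1; rewrite -er es.
- by rewrite /set_row_time; lia.
Qed.

Record emitted s (K N : nat) (X : R) : Prop := Emitted {
  em_numbered : exists dep p b,
    numbered r c K N dep (iarr s a_par) (iarr s a_let) p b /\
    \sum_(K <= v < N) dep v = X;
  em_term : iarr s a_term = fun v => nat_of_bool (K <= v < N)%N
}.

Definition emit_time : nat := n * (300 * log_time r) + 20.

(** Along the loop, the depths of the terminals numbered so far plus the depths of the remaining
    leaves add up to the recorded cost. *)
Lemma emitP s K : base s -> ivar s v_log = 0%N -> ivar s v_best = K -> K <> 0%N ->
  iarr s a_term = (fun=> 0%N) ->
  runs s emit_leaves emit_time
    (fun s' => ivar s' v_n = (K + n)%N /\ emitted s' K (K + n) (rvar s x_best)).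
Proof.
move=> bs lg eK K0 term; have L0 := log_time_gt0.
set X := rvar s x_best.
pose I s' := [/\ base s',
  numbered r c K (ivar s' v_nodes) (rarr s' a_dep) (iarr s' a_par)
    (iarr s' a_let) (iarr s' a_p) (iarr s' a_b),
  (\sum_(k < r) iarr s' a_b k = ivar s' v_cnt + \sum_(k < r) iarr s' a_p k)%N,
  (ivar s' v_nodes + ivar s' v_cnt = K + n)%N &
  \sum_(K <= v < ivar s' v_nodes) rarr s' a_dep v +
    gsum r (iarr s' a_p) (iarr s' a_b) (value (rarr s' a_dep)) = X] /\
  iarr s' a_term = fun v => nat_of_bool (K <= v < ivar s' v_nodes)%N.
pose f s' := (ivar s' v_cnt * (290 * log_time r))%N.
set pre1 := ISetVar v_nodes (IVar v_best).
set pre2 := ISetVar v_cnt (IVar v_n).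
have [[e0 e1 e2] ok0 [l0 b0]] := bs.
have [g1 g2 g3 g4] := b0 ltac:(by rewrite eK).
rewrite eK in g1 g2; rewrite /restored lg /= in g2 g3 g4.
pose s1 := final (final s pre1) pre2.
apply: (@runs_seq _ _ _ _ 2 (n * (290 * log_time r) + 15) _
   (fun s' => s' = final s pre1)); [exact: runs_final| |by rewrite /emit_time; nia].
move=> _ ->.
apply: (@runs_seq _ _ _ _ 2 (n * (290 * log_time r) + 12) _
   (fun s' => s' = s1)); [exact: runs_final| |by lia].
move=> _ ->.
have I1 : I s1.
  split; last by rewrite /= term; apply/funext => v; rd; rewrite eK; case: ltnP => //; lia.
  split.
  - split => //; split => // _.
    have er : restored s1 = (iarr s a_p, iarr s a_b).
      by rewrite /restored /=; rd; rewrite lg.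
    by rewrite er; split; rewrite /=; rd; rewrite ?eK.
  - by rewrite /=; rd; rewrite eK.
  - by rewrite /=; rd; rewrite e0.
  - by rewrite /=; rd; rewrite eK e0.
  - by rewrite /=; rd; rewrite eK big_geq // add0r -g3.
apply: (@runs_seq _ _ _ _ (n * (290 * log_time r) + 5) 5 _ (fun s' => I s' /\
   ~~ beval s' (BNot (BIeq (IVar v_cnt) (IConst 0))))); last first.
- by lia.
- move=> s2 [[[b2 n2 s2' eN c2] t2]] /=; rewrite negbK => /eqP cnt2.
  apply: runs_final => //=; rd.
  have eN' : ivar s2 v_nodes = (K + n)%N by lia.
  rewrite eN'; split => //; split; last by rewrite /= t2 eN'.
  exists (rarr s2 a_dep), (iarr s2 a_p), (iarr s2 a_b); rewrite -eN'; split => //.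
  (* With no leaf left, the sums of [p] and [b] agree; as p <= b in each row, all rows are empty. *)
  rewrite -c2 [X in _ = _ + X]big1 ?addr0 // => k _.
  have hb (l : 'I_r) : (iarr s2 a_p l <= iarr s2 a_b l)%N.
    by have /andP[] := nb_rows n2 l.
  rewrite big_geq //; have := s2'; rewrite cnt2 add0n (bigD1 k) //= [in RHS](bigD1 k) //=.
  rewrite -[(iarr s2 a_b k <= _)%N](leq_add2r (\sum_(i < r | i != k) iarr s2 a_p i)).
  by move=> <-; rewrite leq_add2l; apply: leq_sum.
apply: (runs_while (f := f)) => //; last by rewrite /f /=; rd; rewrite e0; lia.
move=> s2 [[b2 n2 c2 eN x2] t2] /= hc.
have {}hc : (0 < ivar s2 v_cnt)%N by lia.
pose s3 := final s2 (ISetArr a_term (IVar v_nodes) (IConst 1)).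
have act : exists2 k, (k < r)%N & (iarr s2 a_p k < iarr s2 a_b k)%N.
  by apply: sum_leaf; lia.
exists (280 * log_time r)%N.
apply: (@runs_seq _ _ _ _ 3 (60 + move_time) _ (fun s' => s' = s3)).
- exact: runs_final.
- move=> _ ->.
  have b3 : base s3 by exact: b2.
  have KN := nb_bound n2.
  have : runs s3 pop_node (60 + move_time) (fun s' => base s' /\
     exists v w1 w2 k1 k2, s' = moved (final s3 pop_prelude) v w1 w2 k1 k2).
    apply: runs_popP => // k; have := nb_rows n2 k.
    by change (iarr s3 a_b k) with (iarr s2 a_b k);
      change (ivar s3 v_nodes) with (ivar s2 v_nodes); case: ifP; lia.
  apply: runs_weaken => // s' [bs' [v [w1 [w2 [k1 [k2 es]]]]]].
  have [a1 a2 a3] := min_rowP b2 act; set i0 := min_row_of s2 in a1 a2 a3.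
  have eN' : ivar s' v_nodes = (ivar s2 v_nodes).+1 by rewrite es /=; rd; rewrite addn1.
  have ed : rarr s' a_dep = upd (rarr s2 a_dep) (ivar s2 v_nodes)
    (value (rarr s2 a_dep) (iarr s2 a_p i0) i0) by rewrite es /=; rd; rewrite a3.
  have ep : iarr s' a_p = upd (iarr s2 a_p) i0 (iarr s2 a_p i0).+1.
    by rewrite es /=; rd; rewrite addn1.
  have eb : iarr s' a_b = iarr s2 a_b by rewrite es /=; rd; rewrite upd_id.
  have ec : ivar s' v_cnt = (ivar s2 v_cnt - 1)%N by rewrite es.
  split; last first.
    rewrite /f ec; move: (log_time r) L0 => L L0 /=.
    by case: (ivar s2 v_cnt) hc => // m _; rewrite subn1 /=; nia.
  split; last first.
    rewrite eN' es /=; rd; rewrite t2; apply/funext => u; rewrite /upd.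
    by case: eqP => [->|]; [rewrite ltnSn; case/andP: KN => ->|case: leqP => //=; lia].
  split => //.
  - rewrite eN' ed ep eb.
    have := numbered_pop a2 n2.
    by rewrite es.
  - rewrite eb ep ec; have := sum_upd_nat (iarr s2 a_p) (iarr s2 a_p i0).+1 a1; lia.
  - by rewrite eN' ec; lia.
  - rewrite eN' ed ep eb big_nat_recr /=; last by case/andP: KN.
    rewrite upd_same -x2 [in RHS](gsum_pop _ a1 a2).
    rewrite (eq_big_nat _ _ (F2 := rarr s2 a_dep)); last first.
      by move=> u hu; rewrite upd_other //; lia.
    rewrite (@eq_gsum _ _ _ _ _ (value (rarr s2 a_dep))); first by rewrite [LHS]addrAC [RHS]addrA.
    move=> k j hk hj; rewrite /frontier_value upd_other //.
    by have := nb_rows n2 k; rewrite hk; lia.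
- by rewrite /move_time; lia.
Qed.

Definition program_time : nat := 2000 * log_time r * (work + n).

Lemma code_programP s : initial s ->
  runs s code_program program_time (fun s' => exists K X,
    [/\ ivar s' v_n = (K + n)%N, emitted s' K (K + n) X &
        forall t0, leaves r t0 = n -> X <= cost r c t0]).
Proof.
move=> ini; have [e0 _ _] := in_input ini; have L0 := log_time_gt0.
apply: (@runs_if _ _ _ _ _ (search_time + (undo_time + emit_time))) => /=.
- by rewrite e0 leqNgt n_gt1.
- move=> _; apply: (runs_seq (searchP ini)); last exact: leqnn.
  move=> s1 sd; apply: (runs_seq (undoP sd)); last exact: leqnn.
  move=> s2 [b2 l2 [k1 k2 k3 k4]].
  apply: runs_weaken (emitP b2 l2 k1 (sd_best sd) _) => //.
    move=> s3 [h1 h2]; exists (ivar s1 v_best), (rvar s2 x_best); split => //.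
    by rewrite k2; exact: sd_optimal sd.
  by rewrite k3; exact: sd_term sd.
- have : (log_bound n <= 2 * work)%N.
    rewrite /log_bound /work big_distrr /=; apply: leq_sum => m _; lia.
  rewrite /program_time /search_time /undo_time /emit_time.
  move: (log_time r) (log_bound n) L0 => L B L0 h.
  have : (n <= work + n)%N by lia.
  nia.
Qed.

End Program.
(** * The output *)

Section Output.
Variables (R : realType) (r : nat) (c : 'I_r -> R) (cn : nat -> R) (o : 'I_r).
Hypothesis cnE : forall i : 'I_r, cn i = c i.
Variables (K N : nat) (dep : nat -> R) (par lett p b : nat -> nat).
Hypothesis num : numbered r cn K N dep par lett p b.

(** The default [o] is never reached at a numbered node other than the root, whose letter is below
    r. *)
Definition letter (v : nat) : 'I_r := insubd o (lett v).

(** [k] is fuel; since parents have smaller numbers, v steps suffice for node v. *)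
Fixpoint spell (k v : nat) : word r :=
  if k is k'.+1 then
    if v == 0%N then [::] else rcons (spell k' (par v)) (letter v)
  else [::].

Definition node (v : nat) : word r := spell v v.

Lemma spell_node k v : (v <= k)%N -> (v < N)%N -> spell k v = node v.
Proof.
elim/ltn_ind: k v => -[|k] IH [|v] //= hk hv.
have [h _ _ _ _] := nb_node num (v := v.+1) hv.
have hp : (par v.+1 < N)%N by lia.
by rewrite /node /= !IH //; lia.
Qed.

Lemma node0 : node 0 = [::]. Proof. by []. Qed.

Lemma nodeE v : (0 < v < N)%N -> node v = rcons (node (par v)) (letter v).
Proof.
case: v => // v hv; have [h _ _ _ _] := nb_node num hv.
by rewrite /node /= spell_node //; lia.
Qed.

Lemma letterE v : (0 < v < N)%N -> nat_of_ord (letter v) = lett v.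
Proof. by move=> /(nb_node num)[_ _ h _ _]; rewrite /letter val_insubd h. Qed.

Lemma node_inj v v' : (v < N)%N -> (v' < N)%N -> node v = node v' -> v = v'.
Proof.
elim/ltn_ind: v v' => -[|v] IH [|v'] // hv hv'.
- by rewrite [RHS]nodeE // node0; case: (node (par _)).
- by rewrite [LHS]nodeE // node0; case: (node (par _)).
rewrite nodeE // [RHS]nodeE // => /rcons_inj[e1 e2].
have [h1 _ _ _ _] := nb_node num (v := v.+1) hv.
have [h2 _ _ _ _] := nb_node num (v := v'.+1) hv'.
apply: (nb_inj num) => //; first by apply: IH e1; lia.
by rewrite -letterE // -[RHS]letterE // e2.
Qed.

Lemma word_length_node v : (v < N)%N -> word_length c (node v) = dep v.
Proof.
elim/ltn_ind: v => -[|v] IH hv; first by rewrite /word_length big_nil (nb_root num).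
have [h1 _ _ -> _] := nb_node num (v := v.+1) hv.
rewrite nodeE // /word_length big_rcons /= -/(word_length c (node (par v.+1))).
by rewrite IH //; [rewrite -cnE letterE|lia].
Qed.

Definition all_nodes : {fset word r} := seq_fset tt [seq node v | v <- iota 0 N].
Definition terminals : {fset word r} :=
  seq_fset tt [seq node v | v <- iota K (N - K)].

Lemma all_nodesP u : reflect (exists2 v, (v < N)%N & node v = u) (u \in all_nodes).
Proof.
rewrite seq_fsetE; apply: (iffP mapP) => -[v].
  by rewrite mem_iota => h ->; exists v.
by move=> h <-; exists v; rewrite ?mem_iota.
Qed.

Lemma terminalsP u :
  reflect (exists2 v, (K <= v < N)%N & node v = u) (u \in terminals).
Proof.
rewrite seq_fsetE; apply: (iffP mapP) => -[v].
  by rewrite mem_iota => h ->; exists v => //; lia.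
by move=> h <-; exists v; rewrite ?mem_iota //; lia.
Qed.

(** Terminals have numbers from K on while every parent is below K, so terminals are leaves. *)
Lemma code_tree_nodes : code_tree all_nodes terminals.
Proof.
have N0 : (0 < N)%N by case/andP: (nb_bound num).
split.
  split; first by apply/all_nodesP; exists 0%N.
  move=> u i /all_nodesP[[|v] hv]; first by rewrite node0; case: u.
  rewrite nodeE // => /rcons_inj[<- _]; apply/all_nodesP; exists (par v.+1) => //.
  by have [h _ _ _ _] := nb_node num (v := v.+1) hv; lia.
move=> _ /terminalsP[v hv <-]; split; first by apply/all_nodesP; exists v => //; lia.
move=> i; apply/negP => /all_nodesP[[|v'] hv']; first by rewrite node0; case: (node v).
have [h1 h2 _ _ _] := nb_node num (v := v'.+1) hv'.
rewrite nodeE // => /rcons_inj[e _].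
have : par v'.+1 = v by apply: node_inj e; lia.
by lia.
Qed.

Lemma rooted_prefix (T : {fset word r}) u t :
  rooted_subtree T -> u ++ t \in T -> u \in T.
Proof.
move=> [_ h]; elim/last_ind: t => [|t i IH]; first by rewrite cats0.
by rewrite -rcons_cat => /h.
Qed.

Lemma prefix_free_terminals : prefix_free terminals.
Proof.
have [ro le] := code_tree_nodes.
move=> u v /le[_ hu] /le[hv _] /prefixP[[|i t] e]; first by rewrite e cats0.
have := hu i; rewrite (rooted_prefix (t := t) ro) //.
by rewrite cat_rcons -e.
Qed.

Lemma perm_terminals : perm_eq terminals [seq node v | v <- iota K (N - K)].
Proof.
apply: uniq_perm; first exact: fset_uniq.
  rewrite map_inj_in_uniq ?iota_uniq // => v v'; rewrite !mem_iota => h h'.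
  by apply: node_inj; lia.
by move=> u; rewrite seq_fsetE.
Qed.

Lemma card_terminals : #|` terminals| = (N - K)%N.
Proof. by rewrite (perm_size perm_terminals) size_map size_iota. Qed.

Lemma cost_terminals :
  \sum_(w <- terminals) word_length c w = \sum_(K <= v < N) dep v.
Proof.
rewrite (perm_big _ perm_terminals) big_map; apply: eq_big_seq => v.
by rewrite mem_iota => h; apply: word_length_node; lia.
Qed.

Lemma output_nodes (s : state R) : ivar s v_n = N -> iarr s a_par = par ->
  iarr s a_let = lett -> iarr s a_term = (fun v => nat_of_bool (K <= v < N)%N) ->
  output_tree s all_nodes terminals.
Proof.
move=> e0 e1 e2 e3; exists node; rewrite e0 e1 e2 e3; split.
- by move=> u; split=> [/all_nodesP|h]; last exact/all_nodesP.
- by move=> v v' h h'; exact: node_inj.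
- by case/andP: (nb_bound num).
- move=> v hv; have [h1 h2 h3 h4 h5] := nb_node num hv; split; first lia.
  by exists (letter v); [exact: letterE|exact: nodeE].
move=> v hv; rewrite hv andbT eqb0 negbK; apply/terminalsP/idP.
  by move=> [v' hv' e]; have : v' = v; [apply: node_inj e|]; lia.
by move=> h; exists v => //; rewrite h.
Qed.

End Output.

(** * Running time *)

Section Time.
Variable R : realType.

(** Telescoping of ln(1 - 1/(n+1)) <= -1/(n+1). *)
Lemma sum_inv_le_ln (a n : nat) : (a < n)%N ->
  \sum_(a.+2 <= m < n.+1) m%:R^-1 <= ln n%:R - ln a.+1%:R :> R.
Proof.
elim: n => // n IH; rewrite ltnS leq_eqVlt => /orP[/eqP <-|lt].
  by rewrite big_geq // subrr.
rewrite big_nat_recr //=.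
have n0 : (0 < n)%N by lia.
have : ln (1 + - n.+1%:R^-1) <= - n.+1%:R^-1 :> R.
  by apply: le_ln1Dx; rewrite ltrN2 invf_lt1 ?ltr1n // ltr0n.
have -> : 1 + - n.+1%:R^-1 = n%:R / n.+1%:R :> R.
  by rewrite -[n.+1%:R in RHS]natr1 -natr1; field; rewrite natr1 pnatr_eq0.
rewrite ln_div ?posrE ?ltr0n // => h; apply: le_trans (lerD (IH lt) (lexx _)) _.
move: (ln n%:R) (ln n.+1%:R) (ln a.+1%:R) (n.+1%:R^-1) h => x y z w; lra.
Qed.

(** The sum of [max_children] is split at a = n %/ r. Up to a the bound r gives a r <= n in total.
    Beyond a the bound 1 + n/m gives at most n + n (1 + ln n - ln (a + 1)), and n < r (a + 1). The
    additional 1 per node in [work] gives the fourth n. *)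
Lemma work_le (n r : nat) : (0 < n)%N -> (1 < r)%N ->
  (work n r)%:R <= n%:R * (4 + ln r%:R) :> R.
Proof.
move=> n0 r1; have r0 : (0 < r)%N by lia.
set a := (n %/ r)%N.
have an : (a < n)%N by rewrite ltn_Pdiv.
have nR : 0 < n%:R :> R by rewrite ltr0n.
have -> : (work n r = n + \sum_(1 <= m < n.+1) max_children n r m)%N.
  rewrite /work (eq_bigr (fun m => 1 + max_children n r m)%N) //.
  by rewrite big_split /= sum_nat_const_nat subn1 muln1.
rewrite natrD (@big_cat_nat _ _ _ a.+1) //=; last by lia.
rewrite natrD.
have h1 : (\sum_(1 <= m < a.+1) max_children n r m)%:R <= n%:R :> R.
  rewrite ler_nat; apply: (@leq_trans (a * r)); last exact: leq_trunc_div.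
  apply: (@leq_trans (\sum_(1 <= m < a.+1) r)).
    by apply: leq_sum => m _; rewrite /max_children geq_minl.
  by rewrite sum_nat_const_nat subn1.
have h2 : (\sum_(a.+1 <= m < n.+1) max_children n r m)%:R <=
    n%:R + n%:R * (1 + ln r%:R) :> R.
  have le m : (0 < m)%N -> (max_children n r m)%:R <= 1 + n%:R * m%:R^-1 :> R.
    move=> m0; apply: (@le_trans _ _ (n %/ m).+1%:R).
      by rewrite ler_nat /max_children geq_minr.
    rewrite -natr1 addrC lerD2l ler_pdivlMr ?ltr0n // -natrM ler_nat.
    exact: leq_trunc_div.
  rewrite natr_sum; apply: (@le_trans _ _ (\sum_(a.+1 <= m < n.+1) (1 + n%:R * m%:R^-1))).
    by rewrite big_nat [leRHS]big_nat; apply: ler_sum => m hm; apply: le; lia.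
  rewrite big_split /= -mulr_sumr; apply: lerD.
    by rewrite big_const_nat iter_addr_0 ler_nat; lia.
  rewrite ler_pM2l // big_ltn; last lia.
  apply: lerD; first by rewrite invf_le1 ?ltr0n // ler1n.
  apply: le_trans (sum_inv_le_ln an) _.
  rewrite lerBlDr -lnM ?posrE ?ltr0n // ler_ln ?posrE ?ltr0n //; last first.
    by rewrite -natrM ltr0n; lia.
  by rewrite -natrM ler_nat mulnC ltnW // ltn_ceil.
by rewrite mulrDr; lra.
Qed.

Lemma log_time_le (r : nat) : (1 < r)%N ->
  (log_time r)%:R * ln 2 <= 3 * ln r%:R :> R.
Proof.
move=> r1; rewrite /log_time.
have h2 : ln 2 <= ln r%:R :> R by rewrite ler_ln ?posrE ?ltr0n ?ler_nat //; lia.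
have : (2 ^ trunc_log 2 (r + r) <= 2 * r)%N.
  by rewrite mul2n -addnn; apply: trunc_logP => //; lia.
rewrite -(ler_nat R) natrX natrM => h.
have r0 : 0 < r%:R :> R by rewrite ltr0n; lia.
have : ln (2%:R ^+ trunc_log 2 (r + r)) <= ln (2%:R * r%:R) :> R.
  by rewrite ler_ln ?posrE ?exprn_gt0 ?mulr_gt0 ?ltr0n //; lia.
have -> : ln (2%:R ^+ trunc_log 2 (r + r)) = (trunc_log 2 (r + r))%:R * ln 2 :> R.
  by rewrite lnXn ?ltr0n // mulr_natl.
have -> : ln (2%:R * r%:R) = ln 2 + ln r%:R :> R.
  by rewrite lnM ?posrE ?ltr0n //; lia.
by move=> h'; rewrite -natr1 mulrDl mul1r; lra.
Qed.

(** With L = ln r >= ln 2, this collects 2000 from [program_time], 3 L / ln 2 from [log_time_le],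
    and 5 + L <= L (5 / ln 2 + 1) from [work_le] with one further n. *)
Definition time_factor : R := 6000 / ln 2 * (5 / ln 2 + 1).

Lemma program_time_le (n r : nat) : (0 < n)%N -> (1 < r)%N ->
  (program_time n r)%:R <= time_factor * n%:R * ln r%:R ^+ 2 :> R.
Proof.
move=> n0 r1; have l2 : 0 < ln 2 :> R by rewrite ln_gt0 // ltr1n.
have h2 : ln 2 <= ln r%:R :> R by rewrite ler_ln ?posrE ?ltr0n ?ler_nat //; lia.
have nR : 0 < n%:R :> R by rewrite ltr0n.
set L := ln r%:R in h2 *.
have hL : (log_time r)%:R <= 3 * L / ln 2.
  by rewrite ler_pdivlMr //; exact: log_time_le.
have hw : (work n r + n)%:R <= n%:R * (L * (5 / ln 2 + 1)).
  rewrite natrD; apply: (@le_trans _ _ (n%:R * (5 + L))).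
    by have := work_le n0 r1; rewrite -/L !mulrDr; lra.
  rewrite ler_pM2l // mulrDr mulr1 lerD2r mulrA ler_pdivlMr //.
  by rewrite mulrC ler_pM2r.
rewrite /program_time !natrM.
apply: (@le_trans _ _ (2000 * (3 * L / ln 2) * (n%:R * (L * (5 / ln 2 + 1))))).
  apply: ler_pM => //; first by rewrite mulr_ge0.
  by rewrite ler_pM2l.
rewrite le_eqVlt; apply/orP; left; apply/eqP.
by rewrite /time_factor expr2; field; rewrite gt_eqF.
Qed.

End Time.

Theorem mainTheorem1 (R : realType) :
  exists (p : cmd) (K : R),
    forall (n r : nat) (c : 'I_r -> R),
      (1 <= n)%N -> (2 <= r)%N ->
      (forall i : 'I_r, 0 <= c i) ->
      (forall i j : 'I_r, (i <= j)%N -> c i <= c j) ->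
      exists (t : nat) (s : state R) (T W : {fset word r}),
        [/\ exec (input_state n c) p t s,
            t%:R <= K * n%:R * (ln r%:R) ^+ 2,
            output_tree s T W,
            code_tree T W
          & optimal_code c n W].
Proof.
exists code_program, (time_factor R) => n r c n1 r2 c_ge0 c_mono.
set s0 := input_state n c; pose cn := rarr s0 a_c.
have cnE (i : 'I_r) : cn i = c i by rewrite /cn /= valK.
have cn_ge0 i : (i < r)%N -> 0 <= cn i.
  by move=> hi; rewrite -[i]/(nat_of_ord (Ordinal hi)) cnE.
have cn_mono i j : (i <= j)%N -> (j < r)%N -> cn i <= cn j.
  move=> hij hj; have hi : (i < r)%N by lia.
  rewrite -[i]/(nat_of_ord (Ordinal hi)) -[j]/(nat_of_ord (Ordinal hj)) !cnE.
  exact: c_mono.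
have [t [s [ex le [K [X [eN [[dep [p [b [num cost_eq]]]] term] opt]]]]]] :
    runs s0 code_program (program_time n r) (fun s' => exists K X,
      [/\ ivar s' v_n = (K + n)%N, emitted r cn s' K (K + n) X &
          forall t0, leaves r t0 = n -> X <= cost r cn t0]).
  case: n n1 @s0 @cn cnE cn_ge0 cn_mono => [//|[|n]] _ s0 cn cnE cn_ge0 cn_mono.
    (* For n = 1 there are K = 0 internal nodes: the root is the only node and the only terminal, at
       depth 0. *)
    apply: (@runs_if _ _ _ _ _ 3) => //=; last first.
    - by rewrite /program_time /log_time; nia.
    - move=> _; apply: runs_final => //=; exists 0%N, 0; split => //.
      + split => //=; last by apply/funext => -[|v] //; rd; rewrite /upd /=; case: ltnP.
        exists (fun=> 0), (fun=> 0%N), (fun=> 0%N); split; last by rewrite big_nat1.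
        by split => //; lia.
      + by move=> t0 _; exact: cost_ge0.
  apply: code_programP => //.
  split => //; first by move=> [|[|x]].
  by move=> [|a].
pose o := Ordinal (ltnW r2).
exists t, s, (all_nodes o (K + n) (iarr s a_par) (iarr s a_let)),
  (terminals o K (K + n) (iarr s a_par) (iarr s a_let)); split => //.
- apply: le_trans (program_time_le R n1 r2); rewrite ler_nat //.
- exact: (output_nodes o num).
- exact: (code_tree_nodes o num).
split; first exact: (prefix_free_terminals num).
  by rewrite (card_terminals o num) addKn.
move=> W' pf card.
rewrite /average_length (card_terminals o num) addKn card.
rewrite ler_pM2r ?invr_gt0 ?ltr0n // (cost_terminals o cnE num) cost_eq.
(* Both averages have denominator n, so total lengths are compared, and the competing code enters as
   a tree. *)
have [t0 [lf <-]] := code_ctree cnE (fset_uniq W') pf.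
by apply: opt; rewrite lf.
Qed.
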